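(* Let $\mathcal C$ be a perfect modular fusion category (over $\mathbb C$). Then $K(\mathcal C)$ is Burnside if and only if $\mathcal C$ is integral; likewise, $K(\mathcal C)$ is dual-Burnside if and only if $\mathcal C$ is integral.
   Context: $X_1,\dots,X_m$ are representatives of the isomorphism classes of simple objects of $\mathcal C$, $x_i=[X_i]\in K(\mathcal C)$ (the Grothendieck ring), $d_i=\mathrm{FPdim}(X_i)$ the Frobenius–Perron dimension. Integral: $d_i\in\mathbb Z$ for all $i$. Perfect: the only invertible simple object is the unit object, up to isomorphism. Let $H=K(\mathcal C)\otimes\mathbb C$ and let $\widehat{\mathcal B}=\{\mu_1=\mathrm{FPdim},\mu_2,\dots,\mu_m\}$ be the set of unital algebra morphisms $H\to\mathbb C$, a basis of $H^*$. $x_i$ is grouplike if $x_i[X_i^*]=1$ (equivalently $X_i$ invertible). $K(\mathcal C)$ is Burnside if for every $i$: there is $\mu\in\widehat{\mathcal B}$ with $\mu(x_i)=0$ if and only if $x_i$ is not grouplike. The dual hypergroup of $K(\mathcal C)$ is $H^*$ with basis $\widehat{\mathcal B}$, product $(f\star g)(x_i/d_i)=f(x_i/d_i)g(x_i/d_i)$ for all $i$, unit $\mu_1$, involution $\mu_{j^\#}(x_i)=\mu_j([X_i^*])$. Write $\mu_i\star\mu_j=\sum_k\widehat p_k(i,j)\mu_k$; $\mu_j$ is grouplike in the dual if $\mu_j\star\mu_{j^\#}=\widehat p_1(j,j^\#)\mu_1$. $K(\mathcal C)$ is dual-Burnside if for every $\mu_j\in\widehat{\mathcal B}$: there is $i$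 with $\mu_j(x_i)=0$ if and only if $\mu_j$ is not grouplike in the dual. *)

(* Defs.v *)
From HB Require Import structures.
From mathcomp Require Import all_boot all_order all_algebra.
From mathcomp Require Import complex.
From mathcomp Require Import classical_sets reals.

Set Implicit Arguments.
Unset Strict Implicit.
Unset Printing Implicit Defensive.

Import Order.TTheory GRing.Theory Num.Theory.

Local Open Scope ring_scope.
Local Open Scope complex_scope.

Declare Scope cat_scope.
Delimit Scope cat_scope with cat.
Local Open Scope cat_scope.

Reserved Notation "g ∘ f" (at level 40, left associativity).
Reserved Notation "X ⊗ Y" (at level 38, left associativity).
Reserved Notation "f ⊠ g" (at level 38, left associativity).

Record linearCategory (K : fieldType) := LinearCategory {
  obj :> Type;
  hom : obj -> obj -> vectType K;
  idm : forall X, hom X X;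
  comp : forall X Y Z, hom Y Z -> hom X Y -> hom X Z;
  comp_idl : forall X Y (f : hom X Y), comp (idm Y) f = f;
  comp_idr : forall X Y (f : hom X Y), comp f (idm X) = f;
  compA : forall X Y Z W (h : hom Z W) (g : hom Y Z) (f : hom X Y),
    comp h (comp g f) = comp (comp h g) f;
  comp_linearl : forall X Y Z (a : K) (g g' : hom Y Z) (f : hom X Y),
    comp (a *: g + g') f = a *: comp g f + comp g' f;
  comp_linearr : forall X Y Z (a : K) (g : hom Y Z) (f f' : hom X Y),
    comp g (a *: f + f') = a *: comp g f + comp g f'
}.
Arguments hom {K l} X Y.
Arguments idm {K l} X.
Arguments comp {K l X Y Z} g f.

Notation "g ∘ f" := (comp g f) : cat_scope.

Section LinearCategoryTheory.
Variables (K : fieldType) (C : linearCategory K).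

Definition is_iso (X Y : C) (f : hom X Y) : Prop :=
  exists g : hom Y X, g ∘ f = idm X /\ f ∘ g = idm Y.

Definition isomorphic (X Y : C) : Prop := exists f : hom X Y, is_iso f.

Definition is_mono (X Y : C) (f : hom X Y) : Prop :=
  forall (Z : C) (g h : hom Z X), f ∘ g = f ∘ h -> g = h.

Definition is_epi (X Y : C) (f : hom X Y) : Prop :=
  forall (Z : C) (g h : hom Y Z), g ∘ f = h ∘ f -> g = h.

Definition is_zero (X : C) : Prop :=
  (forall Y (f : hom X Y), f = 0) /\ (forall Y (f : hom Y X), f = 0).

(* [X] is the direct sum of the finite family [Y]; for [n = 0] this says
   that [X] is a zero object. *)
Definition is_direct_sum (n : nat) (Y : 'I_n -> C) (X : C) : Prop :=
  exists (inj : forall i, hom (Y i) X) (prj : forall i, hom X (Y i)),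
    [/\ forall i, prj i ∘ inj i = idm (Y i),
        forall i j, i != j -> prj i ∘ inj j = 0
      & \sum_(i < n) inj i ∘ prj i = idm X].

Definition is_kernel (X Y Z : C) (f : hom X Y) (k : hom Z X) : Prop :=
  f ∘ k = 0 /\
  forall W (g : hom W X), f ∘ g = 0 ->
    exists h : hom W Z, k ∘ h = g /\ forall h', k ∘ h' = g -> h' = h.

Definition is_cokernel (X Y Z : C) (f : hom X Y) (q : hom Y Z) : Prop :=
  q ∘ f = 0 /\
  forall W (g : hom Y W), g ∘ f = 0 ->
    exists h : hom Z W, h ∘ q = g /\ forall h', h' ∘ q = g -> h' = h.

Definition abelian_category : Prop :=
  [/\ forall n (Y : 'I_n -> C), exists X, is_direct_sum Y X,
      forall (X Y : C) (f : hom X Y), exists Z (k : hom Z X), is_kernel f k,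
      forall (X Y : C) (f : hom X Y), exists Z (q : hom Y Z), is_cokernel f q,
      forall (X Y : C) (f : hom X Y), is_mono f ->
        exists Z (g : hom Y Z), is_kernel g f
    & forall (X Y : C) (f : hom X Y), is_epi f ->
        exists Z (g : hom Z X), is_cokernel g f].

Definition simple_object (X : C) : Prop :=
  ~ is_zero X /\
  forall (Y : C) (f : hom Y X), is_mono f -> is_zero Y \/ is_iso f.

Definition semisimple_category : Prop :=
  forall X : C, exists n (Y : 'I_n -> C),
    (forall i, simple_object (Y i)) /\ is_direct_sum Y X.

Definition simple_representatives (n : nat) (X : 'I_n -> C) : Prop :=
  [/\ forall i, simple_object (X i),
      forall i j, isomorphic (X i) (X j) -> i = j
    & forall Y, simple_object Y -> exists i, isomorphic Y (X i)].

End LinearCategoryTheory.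

(* Nothing is assumed strict; the tensor product is bilinear on morphisms. *)
Record monoidalCategory (K : fieldType) := MonoidalCategory {
  mon_cat :> linearCategory K;
  tens : mon_cat -> mon_cat -> mon_cat;
  tensm : forall X X' Y Y' : mon_cat,
    hom X X' -> hom Y Y' -> hom (tens X Y) (tens X' Y');
  unit_obj : mon_cat;
  assoc : forall X Y Z, hom (tens (tens X Y) Z) (tens X (tens Y Z));
  assoc_inv : forall X Y Z, hom (tens X (tens Y Z)) (tens (tens X Y) Z);
  lunit : forall X, hom (tens unit_obj X) X;
  lunit_inv : forall X, hom X (tens unit_obj X);
  runit : forall X, hom (tens X unit_obj) X;
  runit_inv : forall X, hom X (tens X unit_obj);
  tensm_id : forall X Y, tensm (idm X) (idm Y) = idm (tens X Y);
  tensm_comp : forall X X' X'' Y Y' Y''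
      (g : hom X' X'') (f : hom X X') (g' : hom Y' Y'') (f' : hom Y Y'),
    tensm (g ∘ f) (g' ∘ f') = tensm g g' ∘ tensm f f';
  tensm_linearl : forall X X' Y Y' (a : K) (f f' : hom X X') (g : hom Y Y'),
    tensm (a *: f + f') g = a *: tensm f g + tensm f' g;
  tensm_linearr : forall X X' Y Y' (a : K) (f : hom X X') (g g' : hom Y Y'),
    tensm f (a *: g + g') = a *: tensm f g + tensm f g';
  assocK : forall X Y Z, assoc_inv X Y Z ∘ assoc X Y Z = idm _;
  assocVK : forall X Y Z, assoc X Y Z ∘ assoc_inv X Y Z = idm _;
  lunitK : forall X, lunit_inv X ∘ lunit X = idm _;
  lunitVK : forall X, lunit X ∘ lunit_inv X = idm _;
  runitK : forall X, runit_inv X ∘ runit X = idm _;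
  runitVK : forall X, runit X ∘ runit_inv X = idm _;
  assoc_nat : forall X X' Y Y' Z Z'
      (f : hom X X') (g : hom Y Y') (h : hom Z Z'),
    assoc X' Y' Z' ∘ tensm (tensm f g) h
      = tensm f (tensm g h) ∘ assoc X Y Z;
  lunit_nat : forall X Y (f : hom X Y),
    lunit Y ∘ tensm (idm unit_obj) f = f ∘ lunit X;
  runit_nat : forall X Y (f : hom X Y),
    runit Y ∘ tensm f (idm unit_obj) = f ∘ runit X;
  pentagon : forall X Y Z W,
    assoc X Y (tens Z W) ∘ assoc (tens X Y) Z W
      = tensm (idm X) (assoc Y Z W) ∘ assoc X (tens Y Z) W
          ∘ tensm (assoc X Y Z) (idm W);
  triangle : forall X Y,
    tensm (idm X) (lunit Y) ∘ assoc X unit_obj Y = tensm (runit X) (idm Y)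
}.
Arguments tens {K m} X Y.
Arguments tensm {K m X X' Y Y'} f g.
Arguments unit_obj {K} m.
Arguments assoc {K m} X Y Z.
Arguments assoc_inv {K m} X Y Z.
Arguments lunit {K m} X.
Arguments lunit_inv {K m} X.
Arguments runit {K m} X.
Arguments runit_inv {K m} X.

Notation "X ⊗ Y" := (tens X Y) : cat_scope.
Notation "f ⊠ g" := (tensm f g) : cat_scope.

Definition is_left_dual (K : fieldType) (C : monoidalCategory K) (X X' : C)
    (ev : hom (X' ⊗ X) (unit_obj C)) (coev : hom (unit_obj C) (X ⊗ X')) :
    Prop :=
  runit X ∘ (idm X ⊠ ev) ∘ assoc X X' X ∘ (coev ⊠ idm X) ∘ lunit_inv X
    = idm X /\
  lunit X' ∘ (ev ⊠ idm X') ∘ assoc_inv X' X X' ∘ (idm X' ⊠ coev)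
    ∘ runit_inv X' = idm X'.

Record rigidCategory (K : fieldType) := RigidCategory {
  rig_mon :> monoidalCategory K;
  dual : rig_mon -> rig_mon;
  ev : forall X, hom (dual X ⊗ X) (unit_obj rig_mon);
  coev : forall X, hom (unit_obj rig_mon) (X ⊗ dual X);
  dualP : forall X, is_left_dual (ev X) (coev X);
  right_dual_ex : forall X, exists Y : rig_mon,
    exists (e : hom (X ⊗ Y) (unit_obj rig_mon))
           (c : hom (unit_obj rig_mon) (Y ⊗ X)), is_left_dual e c
}.
Arguments dual {K r} X.
Arguments ev {K r} X.
Arguments coev {K r} X.

Definition dualm (K : fieldType) (C : rigidCategory K) (X Y : C)
    (f : hom X Y) : hom (dual Y) (dual X) :=
  lunit (dual X) ∘ (ev Y ⊠ idm (dual X)) ∘ assoc_inv (dual Y) Y (dual X)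
    ∘ (idm (dual Y) ⊠ (f ⊠ idm (dual X))) ∘ (idm (dual Y) ⊠ coev X)
    ∘ runit_inv (dual Y).

Definition invertible_object (K : fieldType) (C : rigidCategory K) (X : C) :
    Prop := is_iso (ev X) /\ is_iso (coev X).

(* [simp 0], ..., [simp rank] are the chosen representatives of the
   isomorphism classes of simple objects, so there are [rank.+1] of them;
   [simp 0] is not required to be the unit object. *)
Record fusionCategory (K : fieldType) := FusionCategory {
  fus_rig :> rigidCategory K;
  fus_abelian : abelian_category fus_rig;
  fus_semisimple : semisimple_category fus_rig;
  rank : nat;
  simp : 'I_rank.+1 -> fus_rig;
  simpP : simple_representatives simp;
  fus_unit : \dim {: hom (unit_obj fus_rig) (unit_obj fus_rig)} = 1%N
}.
Arguments rank {K} f.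
Arguments simp {K f} i.

Record ribbonFusionCategory (K : fieldType) := RibbonFusionCategory {
  rib_fus :> fusionCategory K;
  braid : forall X Y : rib_fus, hom (X ⊗ Y) (Y ⊗ X);
  braid_iso : forall X Y, is_iso (braid X Y);
  braid_nat : forall (X X' Y Y' : rib_fus) (f : hom X X') (g : hom Y Y'),
    braid X' Y' ∘ (f ⊠ g) = (g ⊠ f) ∘ braid X Y;
  hexagon1 : forall X Y Z,
    assoc Y Z X ∘ braid X (Y ⊗ Z) ∘ assoc X Y Z
      = (idm Y ⊠ braid X Z) ∘ assoc Y X Z ∘ (braid X Y ⊠ idm Z);
  hexagon2 : forall X Y Z,
    assoc_inv Z X Y ∘ braid (X ⊗ Y) Z ∘ assoc_inv X Y Z
      = (braid X Z ⊠ idm Y) ∘ assoc_inv X Z Y ∘ (idm X ⊠ braid Y Z);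
  twist : forall X : rib_fus, hom X X;
  twist_iso : forall X, is_iso (twist X);
  twist_nat : forall (X Y : rib_fus) (f : hom X Y),
    twist Y ∘ f = f ∘ twist X;
  twist_tens : forall X Y,
    twist (X ⊗ Y) = (twist X ⊠ twist Y) ∘ braid Y X ∘ braid X Y;
  twist_dual : forall X, twist (dual X) = dualm (twist X)
}.
Arguments braid {K r} X Y.
Arguments twist {K r} X.

(* The coordinate of an endomorphism of the unit object in the basis [id]
   of the line End(1). *)
Definition unit_scalar (K : fieldType) (C : fusionCategory K)
    (f : hom (unit_obj C) (unit_obj C)) : K :=
  coord [tuple of [:: idm (unit_obj C)]] ord0 f.

(* The trace for the spherical structure given by the twist and the
   Drinfeld isomorphism X -> X**. *)
Definition ribbon_trace (K : fieldType) (C : ribbonFusionCategory K) (X : C)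
    (f : hom X X) : K :=
  unit_scalar (ev X ∘ braid X (dual X) ∘ ((twist X ∘ f) ⊠ idm (dual X))
                 ∘ coev X).

Definition Smatrix (K : fieldType) (C : ribbonFusionCategory K) :
    'M[K]_((rank C).+1) :=
  \matrix_(i, j) ribbon_trace (braid (simp j) (simp i) ∘ braid (simp i) (simp j)).

Record modularCategory (K : fieldType) := ModularCategory {
  modular_rib :> ribbonFusionCategory K;
  modular_nondegenerate : Smatrix modular_rib \in unitmx
}.

Section Grothendieck.
Variables (K : fieldType) (C : fusionCategory K).

Local Notation m := (rank C).+1.

(* The multiplicity [Y : X_k]; over an algebraically closed field it is the
   dimension of Hom(X_k, Y). *)
Definition multiplicity (Y : C) (k : 'I_m) : nat := \dim {: hom (simp k) Y}.

(* K(C) (x) A, the free A-module on the isomorphism classes of simple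
   objects; K(C) itself is [Groth int]. *)
Definition Groth (A : comNzRingType) := 'rV[A]_m.

Definition gbasis (A : comNzRingType) (i : 'I_m) : Groth A := delta_mx 0 i.

Definition gclass (A : comNzRingType) (Y : C) : Groth A :=
  \sum_k (multiplicity Y k)%:R *: gbasis A k.

Definition gone (A : comNzRingType) : Groth A := gclass A (unit_obj C).

Definition gmul (A : comNzRingType) (u v : Groth A) : Groth A :=
  \sum_i \sum_j (u 0 i * v 0 j) *: gclass A (simp i ⊗ simp j).

Definition grouplike (i : 'I_m) : Prop :=
  gmul (gbasis int i) (gclass int (dual (simp i))) = gone int.

(* The matrix of left multiplication by x_i; it acts on row vectors, as
   [eigenvalue] expects. *)
Definition fusion_mx (A : comNzRingType) (i : 'I_m) : 'M[A]_m :=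
  \matrix_(j, k) (multiplicity (simp i ⊗ simp j) k)%:R.

Definition perfect : Prop :=
  forall X : C, simple_object X -> invertible_object X ->
    isomorphic X (unit_obj C).

End Grothendieck.
Arguments gbasis {K C} A i.
Arguments gclass {K C} A Y.
Arguments gone {K} C A.
Arguments fusion_mx {K C} A i.

Section Burnside.
Variables (R : realType) (C : fusionCategory R[i]).

Local Notation m := (rank C).+1.
Local Notation H := (Groth C R[i]).
Local Notation Hdual := 'Hom('rV[R[i]]_m, R[i]^o).
Local Notation x i := (gbasis R[i] i).

(* The largest nonnegative real eigenvalue of left multiplication by x_i. *)
Definition FPdim (i : 'I_m) : R :=
  sup [set r : R | 0 <= r /\ eigenvalue (fusion_mx R i) r]%classic.

Definition integral_category : Prop :=
  forall i : 'I_m, exists z : int, FPdim i = z%:~R.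

Definition algebra_morphism (f : Hdual) : Prop :=
  f (gone C R[i]) = 1 /\ forall u v : H, f (gmul u v) = f u * f v.

Definition burnside : Prop :=
  forall i : 'I_m,
    (exists f : Hdual, algebra_morphism f /\ f (x i) = 0) <-> ~ grouplike i.

(* The linear form on H taking the value [a i] at x_i. *)
Definition form (a : 'I_m -> R[i]) : Hdual :=
  linfun (fun u : 'rV[R[i]]_m => \sum_i u 0 i * a i : R[i]^o).

Lemma formE (a : 'I_m -> R[i]) (i : 'I_m) : form a (x i) = a i.
Proof.
have lin : linear (fun u : 'rV[R[i]]_m => \sum_i u 0 i * a i : R[i]^o).
  move=> c u v; rewrite scaler_sumr -big_split /=; apply: eq_bigr => j _.
  by rewrite !mxE mulrDl -mulrA.
pose F := GRing.isLinear.Build _ _ _ _ _ lin.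
pose L : {linear 'rV[R[i]]_m -> R[i]^o} := HB.pack (fun u : 'rV[R[i]]_m => \sum_i u 0 i * a i : R[i]^o) F.
rewrite /form -[X in linfun X]/(L : _ -> _) lfunE /= (bigD1 i) //= big1.
  by rewrite mxE !eqxx mul1r addr0.
by move=> j ji; rewrite mxE (negPf ji) andbF mul0r.
Qed.

Definition FPdim_char : Hdual := form (fun i => (FPdim i)%:C).

(* (f * g)(x_i / d_i) = f(x_i / d_i) g(x_i / d_i) *)
Definition star (f g : Hdual) : Hdual :=
  form (fun i => let d := (FPdim i)%:C in
                 d * (f (d^-1 *: x i) * g (d^-1 *: x i))).

(* The involution mu |-> mu^#. *)
Definition sharp (f : Hdual) : Hdual :=
  form (fun i => f (gclass R[i] (dual (simp i)))).

(* [mu] enumerates the set of algebra morphisms H -> C, starting with FPdim;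
   it has as many members as there are simple objects. *)
Definition dual_basis (mu : m.-tuple Hdual) : Prop :=
  [/\ tnth mu ord0 = FPdim_char,
      forall f : Hdual, f \in mu <-> algebra_morphism f
    & basis_of {: Hdual} mu].

Definition dual_coef (mu : m.-tuple Hdual) (k i j : 'I_m) : R[i] :=
  coord mu k (star (tnth mu i) (tnth mu j)).

Definition dual_grouplike (mu : m.-tuple Hdual) (j : 'I_m) : Prop :=
  exists js : 'I_m, tnth mu js = sharp (tnth mu j) /\
    star (tnth mu j) (tnth mu js) = dual_coef mu ord0 j js *: tnth mu ord0.

(* The condition does not depend on the chosen enumeration of the algebra
   morphisms. *)
Definition dual_burnside : Prop :=
  exists mu : m.-tuple Hdual, dual_basis mu /\
    forall j : 'I_m,
      (exists i : 'I_m, tnth mu j (x i) = 0) <-> ~ dual_grouplike mu j.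

End Burnside.

(* Main.v *)
(** Let S be the S-matrix and chi_k(x_i) = S_ki / S_k0.  The loop of an object
    around a simple object X_k is a scalar, additive and multiplicative in the
    object, and S_ki is this scalar times the dimension of X_k; hence the chi_k
    are the characters of the fusion ring, and nondegeneracy makes them a
    basis.  The formal codegrees f_k = sum_i |chi_k(x_i)|^2 satisfy
    f_k |S_k0|^2 = constant, because S * conj S is diagonal and commutes with S.

    Galois theory is replaced by one remark on commuting integer matrices A, B
    with simultaneous eigenvalues a_k, b_k: the leading coefficient of
    det (B^n + X A) is an integer, so the product of the |b_k| over the k with
    a_k = 0 is at least 1 as soon as it is nonzero.

    If C is integral, this gives first dim C = FPdim C, so that f_k d_k^2 is
    constant; then it bounds below the product of the |chi_k(x_i)| over each
    block {k | d_k = d}, for x_i without zeros, and AM-GM with weights d_k^2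
    forces |chi_k(x_i)| = 1.  If C is perfect and K(C) is Burnside, then by the
    symmetry of S a character without zeros is indexed by an invertible object,
    so FPdim is the only one; the product of all the x_i is then killed by all
    the other characters and the traces of its products with the powers of x_i
    show that d_i is an integer.  For the dual property, a character of absolute
    value d is d times a grading, and twisting chi_0 by this grading gives a
    character indexed by an invertible object. *)
From HB Require Import structures.
From mathcomp Require Import all_boot all_order all_algebra.
From mathcomp Require Import fingroup perm complex.
From mathcomp Require Import classical_sets reals.
Require Import Defs.

Set Implicit Arguments.
Unset Strict Implicit.
Unset Printing Implicit Defensive.

Import Order.TTheory GRing.Theory Num.Theory.

Local Open Scope ring_scope.

(** * Commuting integer matrices *)

(** The exponent 1 shows that [r] is rational. Every power of its denominator divides [c], so these
    powers stay bounded and the denominator is 1. *)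
Lemma int_of_int_powers (F : numFieldType) (c : int) (r : F) :
  c != 0 -> (forall n, exists z : int, c%:~R * r ^+ n = z%:~R) ->
  exists z : int, r = z%:~R.
Proof.
move=> c0 cr; have cF0 : c%:~R != 0 :> F by rewrite intr_eq0.
have [z1] := cr 1%N; rewrite expr1 => e1.
pose q : rat := z1%:~R / c%:~R.
have rq : r = ratr q.
  by rewrite /q fmorph_div /= !ratr_int -e1 mulrAC mulfV // mul1r.
have cop := coprime_num_den q.
have d_le n : (`|denq q| ^ n <= `|c|)%N.
  have [z ez] := cr n.
  have : (c * numq q ^+ n = z * denq q ^+ n)%R.
    apply: (@intr_inj F); rewrite !rmorphM !rmorphXn /= -ez.
    have -> : r = (numq q)%:~R / (denq q)%:~R.
      by rewrite -{1}[q]divq_num_den fmorph_div /= !ratr_int in rq.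
    by rewrite -mulrA -exprMn divfK // intr_eq0 denq_neq0.
  move/(congr1 absz); rewrite !abszM !abszX => ec.
  have : (`|denq q| ^ n %| `|c| * `|numq q| ^ n)%N by rewrite ec dvdn_mull.
  rewrite Gauss_dvdl; last first.
    by apply: coprimeXl; apply: coprimeXr; rewrite coprime_sym.
  by move=> /dvdn_leq -> //; rewrite absz_gt0.
have d1 : (`|denq q| = 1)%N.
  have d0 : (0 < `|denq q|)%N by rewrite absz_gt0 denq_neq0.
  apply/eqP; rewrite eqn_leq d0 andbT leqNgt; apply/negP => d2.
  (* The exponent [|c|] suffices: a base of at least 2 raised to it already exceeds [|c|]. *)
  have := d_le `|c|%N; rewrite leqNgt => /negP; apply.
  by apply: ltn_expl.
exists (numq q); rewrite rq -[q in LHS]divq_num_den fmorph_div /= !ratr_int.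
suff -> : denq q = 1 by rewrite divr1.
by rewrite -[denq q]gtz0_abs ?denq_gt0 // d1.
Qed.

Section SimultaneousDiagonalization.
Variables (F : numFieldType) (n : nat).
Variable (P : 'M[F]_n).
Hypothesis Punit : P \in unitmx.

(** The columns of [P] are common eigenvectors of all the matrices in play, so eigenvalues add and
    multiply index by index while the matrices keep integer entries. *)
Definition diagonalizes (A : 'M[int]_n) (a : 'I_n -> F) :=
  map_mx intr A *m P = P *m diag_mx (\row_k a k).

Lemma diagonalizes_mul A B a b : diagonalizes A a -> diagonalizes B b ->
  diagonalizes (A *m B) (fun k => a k * b k).
Proof.
rewrite /diagonalizes map_mxM -mulmxA => eA ->.
rewrite mulmxA eA -mulmxA mulmx_diag; congr (_ *m diag_mx _).
by apply/rowP => k; rewrite !mxE.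
Qed.

Lemma diagonalizes_scalar (z : int) : diagonalizes z%:M (fun=> z%:~R).
Proof.
rewrite /diagonalizes map_scalar_mx mul_scalar_mx -mul_mx_scalar.
congr (_ *m _); apply/matrixP => i j; rewrite !mxE.
by case: (i == j).
Qed.

Lemma diagonalizes_add A B a b : diagonalizes A a -> diagonalizes B b ->
  diagonalizes (A + B) (fun k => a k + b k).
Proof.
rewrite /diagonalizes map_mxD mulmxDl => -> ->.
rewrite -mulmxDr -raddfD; congr (_ *m diag_mx _).
by apply/rowP => k; rewrite !mxE.
Qed.

Lemma diagonalizes_scale (z : int) A a : diagonalizes A a ->
  diagonalizes (z *: A) (fun k => z%:~R * a k).
Proof.
move=> eA; rewrite -mul_scalar_mx.
exact: (diagonalizes_mul (diagonalizes_scalar z) eA).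
Qed.

Lemma diagonalizes_ext A a b : a =1 b -> diagonalizes A a -> diagonalizes A b.
Proof.
by rewrite /diagonalizes => ab ->; congr (_ *m diag_mx _); apply/rowP => k; rewrite !mxE.
Qed.

Lemma diagonalizes_sum (I : finType) (A : I -> 'M[int]_n) (a : I -> 'I_n -> F) :
  (forall i, diagonalizes (A i) (a i)) ->
  diagonalizes (\sum_i A i) (fun k => \sum_i a i k).
Proof.
move=> eA; rewrite /diagonalizes raddf_sum mulmx_suml.
under eq_bigr => i _ do rewrite (eA i).
rewrite -mulmx_sumr -raddf_sum; congr (_ *m diag_mx _).
by apply/rowP => k; rewrite summxE !mxE; apply: eq_bigr => i _; rewrite mxE.
Qed.

Lemma diagonalizes_exp A a (m : nat) : diagonalizes A a ->
  exists B, diagonalizes B (fun k => a k ^+ m).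
Proof.
move=> eA; elim: m => [|m [B eB]].
  by exists 1%:M; apply: diagonalizes_ext (diagonalizes_scalar 1).
exists (A *m B); apply: diagonalizes_ext (diagonalizes_mul eA eB) => k.
by rewrite exprS.
Qed.

Lemma diagonalizes_trace A a : diagonalizes A a ->
  \sum_k a k = (\tr A)%:~R.
Proof.
rewrite /diagonalizes => eA.
have : map_mx intr A = P *m diag_mx (\row_k a k) *m invmx P.
  by rewrite -eA mulmxK.
move/(congr1 mxtrace); rewrite mxtrace_mulC mulKmx // mxtrace_diag => e.
rewrite -trace_map_mx e; apply: eq_bigr => k _; by rewrite mxE.
Qed.

(* The leading coefficient of det(B + X A) is an integer, and it is the
   product of the nonzero eigenvalues of A by the eigenvalues of B on ker A. *)
Lemma diagonalizes_lead A B a b : diagonalizes A a -> diagonalizes B b ->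
  (forall k, a k = 0 -> b k != 0) ->
  exists z : int, \prod_k (if a k == 0 then b k else a k) = z%:~R.
Proof.
move=> eA eB bT.
pose Q : 'M[{poly int}]_n := map_mx polyC B + 'X *: map_mx polyC A.
pose p := \det Q.
pose f := map_poly (intr : int -> F).
(* The same [P] diagonalizes B + X A over the polynomials; its determinant is a nonzero constant and
   cancels. *)
have fp : f p = \prod_k ((b k)%:P + 'X * (a k)%:P).
  have eQ : map_mx f Q *m map_mx polyC P =
      map_mx polyC P *m diag_mx (\row_k ((b k)%:P + 'X * (a k)%:P)).
    have step (M : 'M[int]_n) (c : 'I_n -> F) : diagonalizes M c ->
      map_mx f (map_mx polyC M) *m map_mx polyC P =
      map_mx polyC P *m diag_mx (\row_k (c k)%:P).
      move=> eM; have -> : map_mx f (map_mx polyC M) = map_mx polyC (map_mx intr M).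
        by apply/matrixP => i j; rewrite !mxE /f map_polyC.
      rewrite -map_mxM eM map_mxM map_diag_mx; congr (_ *m diag_mx _).
      by apply/rowP => k; rewrite !mxE.
    have -> : map_mx f Q = map_mx f (map_mx polyC B) + 'X *: map_mx f (map_mx polyC A).
      apply/matrixP => i j; rewrite !mxE /f rmorphD rmorphM /=.
      by rewrite map_polyX.
    rewrite mulmxDl -scalemxAl (step _ _ eA) (step _ _ eB) scalemxAr -mulmxDr.
    congr (_ *m _); apply/matrixP => i j; rewrite !mxE.
    by case: (i == j); rewrite ?mulr1n ?mulr0n ?mulr0 ?addr0.
  have dP : \det (map_mx polyC P) != 0 :> {poly F}.
    by rewrite det_map_mx polyC_eq0 -unitfE -unitmxE.
  have := congr1 determinant eQ; rewrite !det_mulmx mulrC => /(mulfI dP).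
  rewrite det_map_mx det_diag /f /p /= => ->.
  by apply: eq_bigr => k _; rewrite mxE.
exists (lead_coef p); rewrite -(lead_coef_map_inj (f := (intr : int -> F))) //; last exact: intr_inj.
rewrite -/f fp lead_coef_prod; apply: eq_bigr => k _.
case: eqP => [ak|/eqP ak]; first by rewrite ak mulr0 addr0 lead_coefC.
rewrite addrC mulrC mul_polyC lead_coefDl ?lead_coefZ ?lead_coefX ?mulr1 //.
by rewrite size_scale // size_polyX size_polyC; case: (b k == 0).
Qed.

(** Let r be this product and c the product of the nonzero |a_k|. Applied to the powers of B,
    [diagonalizes_lead] makes every r^m c a positive integer; for r < 1 these integers would
    decrease forever. *)
Lemma diagonalizes_norm_ge1 A B a b : diagonalizes A a -> diagonalizes B b ->
  (forall k, a k = 0 -> b k != 0) ->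
  1 <= \prod_(k | a k == 0) `|b k|.
Proof.
move=> eA eB bT; set r := \prod_(k | _) _.
pose c := \prod_(k | a k != 0) `|a k|.
have r0 : 0 < r by apply: prodr_gt0 => k /eqP /bT; rewrite normr_gt0.
have c0 : 0 < c by apply: prodr_gt0 => k; rewrite normr_gt0.
have ex_nat m : exists z : nat, (z > 0)%N /\ r ^+ m * c = z%:R.
  have [Bm eBm] := diagonalizes_exp m eB.
  have bTm k : a k = 0 -> b k ^+ m != 0 by move=> /bT b0; rewrite expf_neq0.
  have [z ez] := diagonalizes_lead eA eBm bTm.
  have e : r ^+ m * c = `|z|%N%:R.
    rewrite -[LHS]/(r ^+ m * c) natr_absz intr_norm -ez normr_prod.
    rewrite (bigID (fun k => a k == 0)) /= /r /c -prodrXl; congr (_ * _).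
      by apply: eq_bigr => k ->; rewrite normrX //.
    by apply: eq_bigr => k /negPf ->.
  exists `|z|%N; split=> //.
  by rewrite -(ltr_nat F) -e mulr_gt0 // exprn_gt0.
have r_real : r \is Num.real by apply: gtr0_real.
rewrite real_leNgt ?real1 //; apply/negP => r1.
(* Each factor r lowers the integer by at least 1, so going back from exponent [m] to exponent 0
   gains at least [m]. *)
have descent m (z : nat) : r ^+ m * c = z%:R -> (z + m)%:R <= c.
  elim: m z => [|m IH] z ez; first by rewrite addn0 -ez mul1r.
  have [y [_ ey]] := ex_nat m.
  apply: le_trans (IH _ ey); rewrite ler_nat addnS -addSn leq_add2r.
  rewrite -(ltr_nat F) -ez -ey exprS -mulrA gtr_pMl // mulr_gt0 //.
  by rewrite exprn_gt0.
have [z0 [_]] := ex_nat 0%N; rewrite mul1r => e0.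
(* The exponent is the integer [c] itself: [descent] then yields [z + c <= c] with [z] positive. *)
have [z [z_gt0 ez]] := ex_nat z0.
have := descent _ _ ez; rewrite e0 ler_nat.
by rewrite leqNgt -[X in (X < _)%N]add0n ltn_add2r z_gt0.
Qed.

(** Only [k0] contributes to the trace of A B^m, so [a k0 * b k0 ^+ m] is an integer for every m;
    the case m = 0 supplies the multiplier of [int_of_int_powers]. *)
Lemma diagonalizes_integral A B a b k0 : diagonalizes A a -> diagonalizes B b ->
  a k0 != 0 -> (forall k, k != k0 -> a k = 0) ->
  exists z : int, b k0 = z%:~R.
Proof.
move=> eA eB ak0 aT.
have tr_eq m : exists z : int, a k0 * b k0 ^+ m = z%:~R.
  have [Bm eBm] := diagonalizes_exp m eB.
  have := diagonalizes_trace (diagonalizes_mul eA eBm).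
  rewrite (bigD1 k0) //= big1 ?addr0 => [-> |k /aT ->]; last by rewrite mul0r.
  by eexists.
have [c ec] := tr_eq 0%N; rewrite expr0 mulr1 in ec.
apply: (int_of_int_powers (c := c)); last by move=> m; rewrite -ec.
by rewrite -(intr_eq0 F) -ec.
Qed.

End SimultaneousDiagonalization.

(** * Characters of a modular fusion ring *)

Section FusionCharacters.
Variables (F : numClosedFieldType) (n : nat).
Local Notation I := 'I_n.
(* [N] are the fusion coefficients, [o] is the index of the unit object, [st]
   the duality of indices and [S] the S-matrix. *)
Variables (N : I -> I -> I -> nat) (o : I) (st : I -> I) (S : 'M[F]_n).
Hypothesis N_frob : forall i j k, N i j k = N (st i) k j.
Hypothesis N_unit : forall i j, N i j o = (j == st i) :> nat.
Hypothesis stK : forall i, st (st i) = i.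
Hypothesis S_unit : S \in unitmx.
Hypothesis S_sym : forall i j, S i j = S j i.
Hypothesis S_o : forall i, S i o != 0.

Definition chi (k i : I) : F := S k i / S k o.

Hypothesis chiM : forall k i j, chi k i * chi k j = \sum_l (N i j l)%:R * chi k l.

Definition fusion_character (f : I -> F) :=
  f o = 1 /\ forall i j, f i * f j = \sum_l (N i j l)%:R * f l.

Lemma chi_character k : fusion_character (chi k).
Proof. by split; [rewrite /chi divff | exact: chiM]. Qed.

Lemma chi_o k : chi k o = 1. Proof. exact: (chi_character k).1. Qed.

Lemma character_normsq_gt0 f : fusion_character f -> 0 < \sum_i `|f i| ^+ 2.
Proof.
move=> [fo _]; rewrite (bigD1 o) //= fo normr1 expr1n.
by rewrite ltr_wpDr ?ltr01 // sumr_ge0 // => i _; rewrite exprn_ge0.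
Qed.

(* Multiplication by x_(st i) is the transpose of multiplication by x_i. *)
Lemma character_adjoint f g i : fusion_character f -> fusion_character g ->
  f i * (\sum_j f j * (g j)^*) = (g (st i))^* * \sum_j f j * (g j)^*.
Proof.
move=> [_ fM] [_ gM]; rewrite !mulr_sumr.
under eq_bigr => j _ do rewrite mulrA fM mulr_suml.
rewrite exchange_big; apply: eq_bigr => l _ /=.
rewrite mulrCA -rmorphM gM rmorph_sum mulr_sumr; apply: eq_bigr => j _.
by rewrite rmorphM rmorph_nat -N_frob mulrCA mulrA.
Qed.

(** Case [g = f] of [character_adjoint], after cancelling the positive sum of the |f_j|^2. *)
Lemma character_st f i : fusion_character f -> f (st i) = (f i)^*.
Proof.
move=> Hf; have /character_adjoint /(_ Hf) e := Hf.
have e0 : \sum_j f j * (f j)^* != 0.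
  apply: lt0r_neq0; rewrite (eq_bigr _ (fun j _ => esym (normCK (f j)))).
  exact: character_normsq_gt0.
by apply: (can_inj conjCK); rewrite conjCK; apply/esym/(mulIf e0); exact: e.
Qed.

(** By adjointness the Hermitian product is killed by [f i - g i] for every [i]: eigenvectors of a
    normal operator for distinct eigenvalues. *)
Lemma character_orthogonal f g : fusion_character f -> fusion_character g ->
  (exists i, f i != g i) -> \sum_j f j * (g j)^* = 0.
Proof.
move=> Hf Hg [i fg]; apply/eqP; have := character_adjoint i Hf Hg.
rewrite (character_st _ Hg) conjCK => /eqP; rewrite -subr_eq0 -mulrBl mulf_eq0.
by rewrite subr_eq0 (negPf fg).
Qed.

Lemma chi_st k i : chi k (st i) = (chi k i)^*.
Proof. exact: character_st (chi_character k). Qed.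

Definition chi_mx : 'M[F]_n := \matrix_(k, i) chi k i.

Lemma chi_mx_unit : chi_mx \in unitmx.
Proof.
have -> : chi_mx = diag_mx (\row_k (S k o)^-1) *m S.
  by apply/matrixP => k i; rewrite mul_diag_mx !mxE mulrC.
rewrite unitmx_mul S_unit andbT unitmxE det_diag unitfE.
by apply/prodf_neq0 => k _; rewrite mxE invr_eq0.
Qed.

Lemma chi_inj k l : (forall i, chi k i = chi l i) -> k = l.
Proof.
move=> kl; have : delta_mx 0 k *m chi_mx = delta_mx 0 l *m chi_mx :> 'rV_n.
  by rewrite -!rowE; apply/rowP => i; rewrite !mxE.
move/(can_inj (mulmxK chi_mx_unit))/rowP/(_ k); rewrite !mxE !eqxx /=.
by case: eqP => // _ /eqP; rewrite oner_eq0.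
Qed.

Lemma chi_separating (u : I -> F) :
  (forall k, \sum_i u i * chi k i = 0) -> forall i, u i = 0.
Proof.
move=> u0 i; have : chi_mx *m (\col_i u i) = 0.
  apply/colP => k; rewrite !mxE -[RHS](u0 k); apply: eq_bigr => l _.
  by rewrite !mxE mulrC.
by move/(canRL (mulKmx chi_mx_unit))/colP/(_ i); rewrite mulmx0 !mxE.
Qed.

(** A character different from every chi_k would be orthogonal to all of them, hence zero by
    [chi_separating], whereas its value at [o] is 1. *)
Lemma character_chi f : fusion_character f -> exists k, f =1 chi k.
Proof.
move=> Hf.
have [/existsP [k /forallP fk]|] :=
    boolP [exists k, forall i, f i == chi k i].
  by exists k => i; apply/eqP.
rewrite negb_exists => /forallP nf.
have : forall i, (f i)^* = 0.
  apply: chi_separating => k; rewrite -[RHS](_ : \sum_j chi k j * (f j)^* = 0).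
    by apply: eq_bigr => i _; rewrite mulrC.
  apply: (character_orthogonal (chi_character k) Hf).
  by have := nf k; rewrite negb_forall => /existsP [i fi]; exists i; rewrite eq_sym.
by move/(_ o)/eqP; rewrite Hf.1 conjC1 oner_eq0.
Qed.

Definition codegree k : F := \sum_i `|chi k i| ^+ 2.

Lemma codegree_gt0 k : 0 < codegree k.
Proof. exact: character_normsq_gt0 (chi_character k). Qed.

Lemma codegree_neq0 k : codegree k != 0.
Proof. exact: lt0r_neq0 (codegree_gt0 k). Qed.

Lemma chi_orthogonality k l :
  \sum_i chi k i * (chi l i)^* = (codegree k) *+ (k == l).
Proof.
case: eqP => [<-|kl]; first by apply: eq_bigr => i _; rewrite normCK.
apply: (character_orthogonal (chi_character k) (chi_character l)).
case: (pickP (fun i => chi k i != chi l i)) => [i ?|e]; first by exists i.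
by case: kl; apply: chi_inj => i; have /negbFE/eqP := e i.
Qed.

(** Row orthogonality gives an explicit right inverse of the character table; being square, the
    table has it as left inverse too, which is column orthogonality. *)
Lemma chi_orthogonality2 i j :
  \sum_k (codegree k)^-1 * ((chi k i)^* * chi k j) = (i == j)%:R.
Proof.
pose D : 'M[F]_n := diag_mx (\row_k (codegree k)^-1).
pose Q : 'M[F]_n := \matrix_(i, k) (chi k i)^*.
have e1 : chi_mx *m (Q *m D) = 1%:M.
  rewrite mulmxA mul_mx_diag; apply/matrixP => k l; rewrite !mxE.
  under eq_bigr => m _ do rewrite !mxE.
  rewrite chi_orthogonality; case: eqP => [<-|_]; last by rewrite mul0r.
  by rewrite divff // codegree_neq0.
have /matrixP/(_ i j) := mulmx1C e1; rewrite !mxE => <-.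
apply: eq_bigr => k _; rewrite mul_mx_diag !mxE.
by rewrite [RHS]mulrAC mulrC.
Qed.

Local Notation L k := (\sum_i chi k i).

Lemma sum_chi_real k : L k \is Num.real.
Proof.
rewrite CrealE rmorph_sum /= (reindex_inj (can_inj stK)) /=.
by apply/eqP; apply: eq_bigr => i _; rewrite chi_st conjCK.
Qed.

(* The Rayleigh quotient of the symmetric operator x_1 + ... + x_n, expanded
   in its eigenbasis. *)
Lemma rayleigh_le (M : F) (w : I -> F) :
  (forall k, L k <= M) -> (forall i, 0 <= w i) ->
  \sum_j w j * (\sum_i \sum_l (N i j l)%:R * w l) <= M * \sum_j w j ^+ 2.
Proof.
move=> LM w0.
(* By column orthogonality, [w] is the combination of the chi_k with coefficients a_k / f_k. *)
pose a k := \sum_m w m * (chi k m)^*.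
have wE l : w l = \sum_k (codegree k)^-1 * a k * chi k l.
  transitivity (\sum_m w m * \sum_k (codegree k)^-1 * ((chi k m)^* * chi k l)).
    rewrite (bigD1 l) //= chi_orthogonality2 eqxx mulr1 big1 ?addr0 // => m ml.
    by rewrite chi_orthogonality2 (negPf ml) mulr0.
  under eq_bigr => m _ do rewrite mulr_sumr.
  rewrite exchange_big; apply: eq_bigr => k _ /=.
  rewrite -mulrA mulr_suml mulr_sumr; apply: eq_bigr => m _.
  by rewrite mulrCA !mulrA.
have aE k : \sum_j w j * chi k j = (a k)^*.
  rewrite rmorph_sum; apply: eq_bigr => j _; rewrite rmorphM /= conjCK.
  by rewrite (CrealP (ger0_real (w0 j))).
have wwE : \sum_j w j ^+ 2 = \sum_k (codegree k)^-1 * `|a k| ^+ 2.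
  transitivity (\sum_j \sum_k (codegree k)^-1 * a k * (w j * chi k j)).
    apply: eq_bigr => j _; rewrite expr2 {2}wE mulr_sumr.
    by apply: eq_bigr => k _; rewrite mulrCA.
  rewrite exchange_big; apply: eq_bigr => k _ /=.
  by rewrite -mulr_sumr aE normCK mulrA.
have -> : \sum_j w j * (\sum_i \sum_l (N i j l)%:R * w l) =
    \sum_k (codegree k)^-1 * `|a k| ^+ 2 * L k.
  transitivity (\sum_j w j * \sum_k (codegree k)^-1 * a k * (L k * chi k j)).
    apply: eq_bigr => j _; congr (_ * _).
    under eq_bigr => i _.
      under eq_bigr => l _ do rewrite wE mulr_sumr.
      rewrite exchange_big /=.
      under eq_bigr => k _ do under eq_bigr => l _ do rewrite mulrCA.
      under eq_bigr => k _ do rewrite -mulr_sumr -chiM.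
      over.
    rewrite exchange_big; apply: eq_bigr => k _ /=.
    by rewrite -mulr_sumr mulr_suml.
  under eq_bigr => j _ do rewrite mulr_sumr.
  rewrite exchange_big; apply: eq_bigr => k _ /=.
  under eq_bigr => j _ do rewrite mulrCA [w j * _]mulrCA.
  by rewrite -mulr_sumr -mulr_sumr aE normCK [L k * _]mulrC !mulrA.
rewrite wwE mulr_sumr; apply: ler_sum => k _.
rewrite mulrC ler_wpM2r ?LM // mulr_ge0 ?exprn_ge0 //.
by rewrite invr_ge0 ltW ?codegree_gt0.
Qed.

(** Choose the character with the largest value L on x_1 + ... + x_n and let [w] be its modulus. The
    triangle inequality bounds L by the sum of [w], and the Rayleigh bound at [w] gives the reverse,
    so the character equals its modulus. *)
Lemma exists_positive_character : exists k, forall i, 0 < chi k i.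
Proof.
pose k0 := [arg max_(k > o | predT k) L k]%O.
have LM k : L k <= L k0.
  by rewrite /k0; case: real_arg_maxP => [//|? _|l _]; [exact: sum_chi_real | apply].
pose w i := `|chi k0 i|.
have w0 i : 0 <= w i by apply: normr_ge0.
have wM i j : w i * w j <= \sum_l (N i j l)%:R * w l.
  rewrite /w -normrM chiM; apply: le_trans (ler_norm_sum _ _ _) _.
  by apply: ler_sum => l _; rewrite normrM normr_nat.
have w2_gt0 : 0 < \sum_j w j ^+ 2 := codegree_gt0 k0.
have wL : \sum_i w i <= L k0.
  rewrite -(ler_pM2r w2_gt0); apply: le_trans (rayleigh_le LM w0).
  rewrite mulr_sumr; apply: ler_sum => j _.
  rewrite expr2 mulrCA ler_wpM2l // mulr_suml; exact: ler_sum.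
have LE : L k0 = \sum_i w i.
  apply/le_anti; rewrite wL andbT.
  by apply: le_trans (ler_norm_sum _ _ _); rewrite real_ler_norm // sum_chi_real.
(* The sum of the values equals the sum of their moduli, so each value equals its modulus. *)
have chiE i : chi k0 i = w i.
  by apply: (@normC_sum_upper _ _ predT (chi k0) w) LE i isT => i _.
exists k0 => i; rewrite chiE normr_gt0; apply/eqP => ci0.
(* A zero at [i] is impossible: the product of x_i with its dual contains the unit, where the
   character is 1. *)
have S_gt0 : 0 < \sum_l (N i (st i) l)%:R * w l.
  rewrite (bigD1 o) //= N_unit eqxx /w chi_o normr1 mulr1.
  by apply: ltr_wpDr => //; apply: sumr_ge0 => l _; rewrite mulr_ge0 ?ler0n.
have := chiM k0 i (st i); rewrite ci0 mul0r.
under eq_bigr => l _ do rewrite chiE.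
by move=> e; rewrite -e ltxx in S_gt0.
Qed.

(** [chi o j] is the categorical dimension of the j-th simple object and [codegree o] the global
    dimension. *)
Lemma codegree_dim j : codegree j * `|chi o j| ^+ 2 = codegree o.
Proof.
pose cS := map_mx Num.conj S.
pose E j : F := codegree j * `|S j o| ^+ 2.
have E1 : S *m cS = diag_mx (\row_j E j).
  apply/matrixP => a k; rewrite !mxE.
  transitivity (S a o * (S k o)^* * \sum_i chi a i * (chi k i)^*).
    rewrite mulr_sumr; apply: eq_bigr => i _; rewrite !mxE (S_sym i k).
    by rewrite mulrACA -rmorphM /chi ![S _ o * _]mulrC !divfK.
  rewrite chi_orthogonality; case: eqP => [<-|_]; last by rewrite mulr0.
  by rewrite !mulr1n /E normCK mulrC.
have E2 : cS *m S = diag_mx (\row_j E j).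
  have -> : S = map_mx Num.conj cS by apply/matrixP => a b; rewrite !mxE conjCK.
  rewrite -map_mxM /= E1 map_diag_mx; congr diag_mx; apply/rowP => k; rewrite !mxE.
  by apply/CrealP; rewrite realM // ger0_real ?exprn_ge0 // ltW // codegree_gt0.
(* Commutation with S, read at the entry (j, o), equates [E j] and [E o], because S has no zero in
   column [o]. *)
have /matrixP/(_ j o) : diag_mx (\row_j E j) *m S = S *m diag_mx (\row_j E j).
  by rewrite -{1}E1 -E2 mulmxA.
rewrite mul_diag_mx mul_mx_diag !mxE mulrC => /(mulfI (S_o j)) Ejo.
rewrite /chi (S_sym o j) normf_div expr_div_n mulrA -/(E j) Ejo.
by rewrite mulfK // expf_neq0 // normr_eq0.
Qed.

(** Both sides equal [S i j / S o o]. As [chi o] has no zero, chi_j vanishes at i exactly when chi_i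
    vanishes at j. *)
Lemma chi_symmetric i j : chi j i * chi o j = chi i j * chi o i.
Proof.
by rewrite /chi (S_sym o j) (S_sym o i) (S_sym i j) !mulrA !divfK.
Qed.

Lemma chi_dim_neq0 j : chi o j != 0.
Proof. by rewrite /chi S_sym mulf_neq0 ?invr_eq0. Qed.

(** * The positive character and Frobenius-Perron dimensions *)

Section FrobeniusPerron.
Variable q : I.
Hypothesis q_gt0 : forall i, 0 < chi q i.

Local Notation d i := (chi q i).

Lemma dim_ge0 i : 0 <= d i. Proof. exact: ltW. Qed.

Lemma dim_st i : d (st i) = d i.
Proof. by rewrite chi_st; apply/CrealP; rewrite gtr0_real. Qed.

(** Pair the moduli of the left eigenvector [v] with the positive right eigenvector [d], whose
    eigenvalue is [d i]. *)
Lemma eigenvalue_le_dim (i : I) (v : I -> F) (r : F) :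
  (exists j, v j != 0) ->
  (forall k, \sum_j v j * (N i j k)%:R = r * v k) -> `|r| <= d i.
Proof.
move=> [j0 vj0] ev.
have pos : 0 < \sum_k `|v k| * d k.
  rewrite (bigD1 j0) //=; apply: ltr_wpDr; last by rewrite mulr_gt0 ?normr_gt0.
  by rewrite sumr_ge0 // => k _; rewrite mulr_ge0 ?dim_ge0.
rewrite -(ler_pM2r pos) mulr_sumr.
apply: (@le_trans _ _ (\sum_k \sum_j `|v j| * ((N i j k)%:R * d k))).
  apply: ler_sum => k _; rewrite mulrA -normrM -ev.
  under [leRHS]eq_bigr => j _ do rewrite mulrA.
  rewrite -mulr_suml ler_wpM2r ?dim_ge0 //; apply: le_trans (ler_norm_sum _ _ _) _.
  by apply: ler_sum => j _; rewrite normrM normr_nat.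
rewrite exchange_big mulr_sumr /=; apply: ler_sum => j _.
by rewrite -mulr_sumr -chiM mulrCA.
Qed.

(** The transpose of multiplication by x_i is multiplication by its dual, which has the same
    dimension; so [d] is a left eigenvector as well. *)
Lemma dim_eigenvector i k : \sum_j d j * (N i j k)%:R = d i * d k.
Proof.
rewrite -(dim_st i) chiM; apply: eq_bigr => j _.
by rewrite N_frob mulrC.
Qed.

(** The conjugate of chi_k is a left eigenvector of x_i with eigenvalue [chi k i]. *)
Lemma chi_le_dim k i : `|chi k i| <= d i.
Proof.
apply: (@eigenvalue_le_dim i (fun j => (chi k j)^*)).
  by exists o; rewrite chi_o conjC1 oner_eq0.
move=> l; rewrite -[chi k i]conjCK -chi_st -rmorphM chiM rmorph_sum.
by apply: eq_bigr => j _; rewrite rmorphM rmorph_nat N_frob mulrC.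
Qed.

Definition fusion_int (i : I) : 'M[int]_n := \matrix_(j, l) (N i j l)%:R.

Lemma fusion_int_diag i : diagonalizes chi_mx^T (fusion_int i) (fun k => chi k i).
Proof.
apply/matrixP => j k; rewrite mul_mx_diag !mxE mulrC chiM.
by apply: eq_bigr => l _; rewrite !mxE rmorph_nat.
Qed.

Lemma chi_mxT_unit : chi_mx^T \in unitmx.
Proof. by rewrite unitmx_tr chi_mx_unit. Qed.

Lemma abs2_diag i :
  diagonalizes chi_mx^T (fusion_int i *m fusion_int (st i)) (fun k => `|chi k i| ^+ 2).
Proof.
apply: diagonalizes_ext (diagonalizes_mul (fusion_int_diag i) (fusion_int_diag (st i))).
by move=> k; rewrite chi_st normCK.
Qed.

Lemma codegree_diag :
  diagonalizes chi_mx^T (\sum_i fusion_int i *m fusion_int (st i)) codegree.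
Proof. exact: (diagonalizes_sum abs2_diag). Qed.

Definition int_dims := forall i, exists z : int, d i = z%:~R.

Lemma prod_le1_eq1 (J : finType) (P : pred J) (y : J -> F) :
  (forall j, P j -> 0 <= y j <= 1) -> 1 <= \prod_(j | P j) y j ->
  forall j, P j -> y j = 1.
Proof.
move=> y01 prod1 j Pj; have /andP [y0 y1] := y01 j Pj.
apply/le_anti; rewrite y1 /=; apply: le_trans prod1 _.
rewrite (bigD1 j) //= -[leRHS]mulr1 ler_wpM2l //.
rewrite [leRHS](_ : 1 = \prod_(k | P k && (k != j)) (1 : F)); last by rewrite big1.
by apply: ler_prod => k /andP [Pk _]; rewrite y01.
Qed.

(** * Zeros of characters under integral dimensions *)

Section Integral.
Hypothesis dint : int_dims.

Let D := \sum_i d i ^+ 2.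

Lemma int_codegree_le k : codegree k <= D.
Proof.
apply: ler_sum => i _; rewrite ler_pXn2r ?nnegrE ?dim_ge0 ?normr_ge0 //.
exact: chi_le_dim.
Qed.

Lemma int_FPdim : exists z : int, D = z%:~R.
Proof.
have [z zE] : exists z : I -> int, forall i, d i = (z i)%:~R.
  exact: (fin_all_exists (U := fun=> int) dint).
exists (\sum_i z i ^+ 2); rewrite rmorph_sum; apply: eq_bigr => i _.
by rewrite zE rmorphXn.
Qed.

Lemma FPdim_gt0 : 0 < D.
Proof. exact: lt_le_trans (codegree_gt0 o) (int_codegree_le o). Qed.

(* Here |chi_o(x_q)|^2 is the ratio of the global dimension of the category
   to its Frobenius-Perron dimension D. *)
Lemma int_dimq : `|chi o q| ^+ 2 = 1.
Proof.
have [z zD] := int_FPdim.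
(* The element D x_q x_(st q) - sum_i x_i x_(st i) has integer coefficients since D is an integer.
   Where its eigenvalue vanishes, |chi_k(x_q)|^2 = f_k / D lies in (0, 1], and a product of at least
   1 forces the value 1; by [codegree_dim] the index [o] is among these. *)
have dA : diagonalizes chi_mx^T _ (fun k => z%:~R * `|chi k q| ^+ 2 + (-1)%:~R * codegree k) :=
  diagonalizes_add (diagonalizes_scale z (abs2_diag q))
    (diagonalizes_scale (-1) codegree_diag).
have aE k : (z%:~R * `|chi k q| ^+ 2 + (-1)%:~R * codegree k == 0) =
    (D * `|chi k q| ^+ 2 == codegree k).
  by rewrite -zD rmorphN1 mulN1r subr_eq0.
have := diagonalizes_norm_ge1 chi_mxT_unit dA (abs2_diag q).
have D0 := lt0r_neq0 FPdim_gt0.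
have val k : D * `|chi k q| ^+ 2 = codegree k -> `|chi k q| ^+ 2 = codegree k / D.
  by move=> <-; rewrite mulrC mulKf.
move=> H; suff : forall k, (z%:~R * `|chi k q| ^+ 2 + (-1)%:~R * codegree k == 0) ->
    `| `|chi k q| ^+ 2 | = 1.
  move/(_ o); rewrite aE normrX normr_id; apply; rewrite -(codegree_dim q).
  apply/eqP; congr (_ * _); apply: eq_bigr => i _.
  by rewrite ger0_norm ?dim_ge0.
apply: prod_le1_eq1.
  move=> k; rewrite aE => /eqP /val e; rewrite normr_ge0 /= e ger0_norm.
    by rewrite ler_pdivrMr ?FPdim_gt0 // mul1r int_codegree_le.
  by rewrite divr_ge0 // ltW ?codegree_gt0 ?FPdim_gt0.
apply: H => k /eqP; rewrite aE => /eqP /val ->.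
by rewrite mulf_neq0 ?invr_eq0 ?codegree_neq0.
Qed.

Lemma int_codegree_o : codegree o = D.
Proof.
rewrite -(codegree_dim q) int_dimq mulr1.
by apply: eq_bigr => i _; rewrite ger0_norm ?dim_ge0.
Qed.

(** The inequality [chi_le_dim] holds term by term and the sums of squares agree, so every term is
    an equality. *)
Lemma int_dimE i : `|chi o i| = d i.
Proof.
apply/eqP; rewrite -(eqrXn2 (ltn0Sn 1)) ?dim_ge0 // eq_sym -subr_eq0.
have : \sum_i (d i ^+ 2 - `|chi o i| ^+ 2) = 0.
  by rewrite big_split /= sumrN -/(codegree o) int_codegree_o subrr.
move/eqP; rewrite psumr_eq0; first by move/allP/(_ i); rewrite mem_index_enum; apply.
move=> k _; rewrite subr_ge0 ler_pXn2r ?nnegrE ?dim_ge0 //.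
exact: chi_le_dim.
Qed.

Lemma int_codegreeE k : codegree k * d k ^+ 2 = D.
Proof. by rewrite -int_dimE codegree_dim int_codegree_o. Qed.

Lemma int_burnside i : (forall k, chi k i != 0) -> forall k, `|chi k i| = 1.
Proof.
move=> nz.
have [e eE] : exists e : I -> nat, forall i, d i = (e i)%:R.
  apply: (fin_all_exists (U := fun=> nat) (P := fun i (t : nat) => d i = t%:R)) => j; have [z zE] := dint j; exists `|z|%N.
  by rewrite natr_absz intr_norm -zE ger0_norm ?dim_ge0.
have e_gt0 k : (0 < e k)%N by rewrite -(ltr_nat F) -eE.
have [z zD] := int_FPdim.
have block (t : nat) : 1 <= \prod_(k | e k == t) `|chi k i|.
  (* As f_k d_k^2 = D, for positive [t] the eigenvalue D - t^2 f_k vanishes exactly on the block d_k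
     = t. *)
  have dA := diagonalizes_add (diagonalizes_scalar chi_mx^T z)
    (diagonalizes_scale (- (t%:R ^+ 2)) codegree_diag).
  have aE k : (t > 0)%N -> (z%:~R + (- (t%:R ^+ 2))%:~R * codegree k == 0) = (e k == t).
    move=> t0; rewrite -zD rmorphN rmorphXn rmorph_nat mulNr subr_eq0.
    rewrite -(int_codegreeE k) mulrC (inj_eq (mulIf (codegree_neq0 k))).
    by rewrite eqrXn2 ?dim_ge0 ?ler0n // eE eqr_nat.
  case: (posnP t) => [->|t0].
    by rewrite big_pred0 // => k; rewrite eqn0Ngt e_gt0.
  have := diagonalizes_norm_ge1 chi_mxT_unit dA (fusion_int_diag i) (fun k _ => nz k).
  by rewrite (eq_bigl (fun k => e k == t)) // => k; rewrite aE.
(* In [A] each index k is repeated d_k^2 times, so the unweighted AM-GM inequality over [A] carries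
   the weights d_k^2. *)
pose J := ('I_n * 'I_((\max_k e k ^ 2).+1))%type.
pose A := [pred p : J | (p.2 < e p.1 ^ 2)%N].
pose G (p : J) := `|chi p.1 i| ^+ 2.
have e_max k : (e k ^ 2 <= (\max_k e k ^ 2).+1)%N.
  by apply: leqW; exact: (leq_bigmax k).
have count k : #|[pred t : 'I_((\max_k e k ^ 2).+1) | (t < e k ^ 2)%N]| = (e k ^ 2)%N.
  rewrite -sum1_card (eq_bigl (fun t : 'I_(_) => (t < e k ^ 2)%N)) //.
  by rewrite (big_ord_narrow (e_max k)) sum1_card card_ord.
have sumA (g : I -> F) : \sum_(p in A) g p.1 = \sum_k (e k ^ 2)%N%:R * g k.
  rewrite (eq_bigl (fun p : J => true && (p.2 < e p.1 ^ 2)%N)) //.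
  rewrite -(pair_big_dep predT (fun k (t : 'I_(_).+1) => t < e k ^ 2)%N (fun k _ => g k)) /=.
  by apply: eq_bigr => k _; rewrite sumr_const count mulr_natl.
have prodA : \prod_(p in A) G p = \prod_k (`|chi k i| ^+ 2) ^+ (e k ^ 2).
  rewrite (eq_bigl (fun p : J => true && (p.2 < e p.1 ^ 2)%N)) //.
  rewrite -(pair_big_dep predT (fun k (t : 'I_(_).+1) => t < e k ^ 2)%N
    (fun k _ => `|chi k i| ^+ 2)) /=.
  by apply: eq_bigr => k _; rewrite prodr_const count.
have cardA : #|A|%:R = D.
  rewrite -sumr_const (sumA (fun=> 1)); apply: eq_bigr => k _.
  by rewrite mulr1 natrX -eE.
(* The mean of [G] over [A] is 1: d_k^2 / D is 1 / f_k, and column orthogonality applies. *)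
have sumG : \sum_(p in A) G p = D.
  rewrite (sumA (fun k => `|chi k i| ^+ 2)).
  have := chi_orthogonality2 i i; rewrite eqxx /= => e1.
  rewrite -[RHS]mulr1 -[X in D * X]e1 mulr_sumr; apply: eq_bigr => k _.
  rewrite natrX -eE -(int_codegreeE k) normCK [(chi k i)^* * _]mulrC.
  by rewrite [codegree k * _]mulrC -[RHS]mulrA mulVKf ?codegree_neq0.
(* Grouped by the value t of d_k, the product consists of the block products raised to the power 2
   t^2. *)
have prodG : 1 <= \prod_(p in A) G p.
  rewrite prodA (partition_big (fun k => inord (e k) : 'I_((\max_k e k).+1)) predT) //=.
  rewrite [leLHS](_ : 1 = \prod_(t < (\max_k e k).+1) (1 : F)); last by rewrite big1.
  apply: ler_prod => t _; rewrite ler01 /=.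
  rewrite (eq_bigl (fun k => e k == t)) => [|k]; last first.
    by rewrite -val_eqE /= inordK // ltnS leq_bigmax.
  rewrite (eq_bigr (fun k => (`|chi k i| ^+ 2) ^+ (t ^ 2))) => [|k /eqP -> //].
  by rewrite !prodrXl -exprM exprn_ege1 // block.
have G0 : {in A, forall p, 0 <= G p} by move=> p _; rewrite exprn_ge0.
(* A mean of 1 and a product of at least 1 give the equality case, in which [G] is constant on
   [A]. *)
have := leif_AGM G0; rewrite sumG cardA divff ?lt0r_neq0 ?FPdim_gt0 // expr1n.
move=> [le1 eq1]; have : \prod_(p in A) G p == 1 by rewrite eq_le le1 prodG.
rewrite eq1 => /forall_inP eqG.
have inA k : ((k, ord0) : J) \in A by rewrite inE /= expn_gt0 e_gt0.
have Gc k l : `|chi k i| ^+ 2 = `|chi l i| ^+ 2.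
  by have /forall_inP/(_ _ (inA l))/eqP := eqG _ (inA k).
move=> k; have G1 : `|chi k i| ^+ 2 = 1.
  move/eqP: sumG; rewrite (eq_bigr (fun=> `|chi k i| ^+ 2)) => [|p _]; last exact: Gc.
  rewrite sumr_const -mulr_natl cardA -subr_eq0 -[X in _ - X]mulr1 -mulrBr mulf_eq0.
  by rewrite (negPf (lt0r_neq0 FPdim_gt0)) /= subr_eq0 => /eqP.
by apply/eqP; rewrite -(eqrXn2 (ltn0Sn 1)) ?normr_ge0 ?ler01 // G1 expr1n.
Qed.

(** By symmetry x_j is killed by no character, so [int_burnside] gives it modulus 1 everywhere, in
    particular d_j = 1. The moduli in [chi_symmetric] then give the claim. *)
Lemma int_dual_burnside j : (forall i, chi j i != 0) -> forall i, `|chi j i| = d i.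
Proof.
move=> nz i.
have nz' k : chi k j != 0.
  have : chi k j * chi o k != 0 by rewrite -chi_symmetric mulf_neq0 ?chi_dim_neq0.
  by rewrite mulf_eq0 negb_or => /andP [].
have abs1 := int_burnside nz'.
have := congr1 (fun x : F => `|x|) (chi_symmetric i j); move=> /=.
rewrite !(normrM (chi _ _) (chi _ _)) !int_dimE abs1 mul1r => <-.
by rewrite -[d j]ger0_norm ?dim_ge0 // abs1 mulr1.
Qed.

End Integral.

Lemma int_dims_of_unique :
  (forall k, (forall i, chi k i != 0) -> k = q) -> int_dims.
Proof.
move=> uniq i.
(* [A] is multiplication by the product of all the x_j; its eigenvalue at k vanishes as soon as
   chi_k has a zero. *)
have [A eA] : exists A, diagonalizes chi_mx^T A (fun k => \prod_j chi k j).
  elim: (index_enum I) => [|j s [A eA]].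
    by exists 1%:M; apply: diagonalizes_ext (diagonalizes_scalar _ 1) => k; rewrite big_nil.
  exists (fusion_int j *m A).
  by apply: diagonalizes_ext (diagonalizes_mul (fusion_int_diag j) eA) => k; rewrite big_cons.
apply: (diagonalizes_integral chi_mxT_unit eA (fusion_int_diag i)).
  by apply/prodf_neq0 => j _; apply: lt0r_neq0.
move=> k kq; apply/eqP; apply: contraNT kq => nz; apply/eqP; apply: uniq => j.
by move/prodf_neq0: nz; apply.
Qed.

(** The spectral form of invertibility: every character takes the value 1 on the product of x_i with
    its dual. *)
Definition abs1 i := forall k, `|chi k i| = 1.

(** By symmetry, a character chi_k without zeros makes x_k avoid all zeros, so k = [o]. The positive
    character is of this kind, hence [q] = [o] too. *)
Lemma burnside_unique (perf : forall i, abs1 i -> i = o) :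
  (forall i, (forall k, chi k i != 0) -> abs1 i) ->
  forall k, (forall i, chi k i != 0) -> k = q.
Proof.
move=> B; have nvo k : (forall i, chi k i != 0) -> k = o.
  move=> nz; apply: perf; apply: B => l.
  have : chi l k * chi o l != 0 by rewrite -chi_symmetric mulf_neq0 ?chi_dim_neq0.
  by rewrite mulf_eq0 negb_or => /andP [].
by move=> k /nvo ->; apply/esym/nvo => i; exact: lt0r_neq0.
Qed.

(* If |chi j| = d then chi j / d is a grading of the fusion ring, and its
   product with the character chi o is the character of an invertible object. *)
Lemma dual_burnside_unique (perf : forall i, abs1 i -> i = o) :
  (forall j, (forall i, chi j i != 0) -> forall i, `|chi j i| = d i) ->
  forall j, (forall i, chi j i != 0) -> j = q.
Proof.
move=> B j /B jd.
pose theta i := chi j i / d i.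
have d0 i : d i != 0 by apply: lt0r_neq0.
have thetaE i : chi j i = theta i * d i by rewrite divfK.
have theta1 i : `|theta i| = 1.
  by rewrite normf_div jd ger0_norm ?dim_ge0 // divff.
(* Taking moduli in the product formula gives equality in the triangle inequality, so all
   constituents of x_a x_b share one phase. *)
have grading a b l : N a b l != 0%N -> theta l = theta a * theta b.
  move=> Nl.
  have eq : `|\sum_l (N a b l)%:R * chi j l| = \sum_l `|(N a b l)%:R * chi j l|.
    rewrite -chiM normrM !jd chiM; apply: eq_bigr => m _.
    by rewrite normrM normr_nat jd.
  have [t _ tE] := normC_sum_eq eq.
  have tE' m : (N a b m)%:R * chi j m = (N a b m)%:R * d m * t.
    by rewrite tE // normrM normr_nat jd.
  have -> : theta a * theta b = t.
    apply: (mulIf (mulf_neq0 (d0 a) (d0 b))).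
    rewrite mulrACA -!thetaE chiM (eq_bigr _ (fun m _ => tE' m)) -mulr_suml.
    by rewrite -chiM mulrC.
  have Nl0 : (N a b l)%:R != 0 :> F by rewrite pnatr_eq0.
  apply: (mulIf (d0 l)); apply: (mulfI Nl0).
  by rewrite -thetaE tE' -mulrA [t * _]mulrC.
have psi : fusion_character (fun i => theta i * chi o i).
  split; first by rewrite /theta !chi_o divr1 mulr1.
  move=> a b; rewrite mulrACA chiM mulr_sumr; apply: eq_bigr => l _.
  have [->|/grading ->] := eqVneq (N a b l) 0%N; first by rewrite !mul0r mulr0.
  by rewrite mulrCA.
have [g gE] := character_chi psi.
(* Symmetry of S together with |theta| = 1 makes the modulus at [g] independent of the character. *)
have absg i : `|chi i g| = `|chi o g|.
  have := congr1 (fun x : F => `|x|) (chi_symmetric g i); rewrite /= !(normrM (chi _ _) (chi _ _)) -(gE i) /= (normrM (theta i)) theta1 mul1r.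
  rewrite [LHS]mulrC => /mulfI; apply.
  by rewrite normr_eq0 chi_dim_neq0.
(* The weights 1 / f_k sum to 1, and by column orthogonality so do the |chi_k(x_g)|^2 / f_k; hence
   the common squared modulus is 1. *)
have g1 : `|chi o g| ^+ 2 = 1.
  have e1 : \sum_k (codegree k)^-1 = 1.
    transitivity (\sum_k (codegree k)^-1 * ((chi k o)^* * chi k o)).
      by apply: eq_bigr => k _; rewrite chi_o conjC1 !mulr1.
    by rewrite chi_orthogonality2 eqxx.
  transitivity (\sum_k (codegree k)^-1 * ((chi k g)^* * chi k g)).
    rewrite -[LHS]mul1r -e1 mulr_suml; apply: eq_bigr => k _.
    by rewrite -(absg k) normCK [(chi k g)^* * _]mulrC.
  by rewrite chi_orthogonality2 eqxx.
have go : g = o.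
  apply: perf => k; rewrite absg.
  by apply/eqP; rewrite -(eqrXn2 (ltn0Sn 1)) ?normr_ge0 ?ler01 // g1 expr1n.
apply: chi_inj => i; rewrite thetaE.
suff -> : theta i = 1 by rewrite mul1r.
by apply: (mulIf (chi_dim_neq0 i)); rewrite gE go mul1r.
Qed.

End FrobeniusPerron.

End FusionCharacters.

(** * Hom spaces of semisimple categories *)

Local Open Scope cat_scope.

Section LinearDimension.
Import VectorInternalTheory.
Variable K : numFieldType.

Definition linear_mx (U V : vectType K) (f : {linear U -> V}) := f2mx (linfun f).

Lemma mul_linear_mx (U V : vectType K) (f : {linear U -> V}) u :
  v2r u *m linear_mx f = v2r (f u).
Proof. by rewrite -(lfunE f u) unlock /= r2vK. Qed.

(** The dimension is the trace of the identity, and the trace is cyclic; characteristic zero turns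
    the equality in [K] into one of natural numbers. *)
Lemma dim_biproduct (V : vectType K) n (U : 'I_n -> vectType K)
    (s : forall i, {linear V -> U i}) (t : forall i, {linear U i -> V}) :
  (forall i, cancel (t i) (s i)) -> (forall v, \sum_i t i (s i v) = v) ->
  \dim {:V} = (\sum_i \dim {:U i})%N.
Proof.
move=> tK sumK; rewrite dimvf; under eq_bigr => i _ do rewrite dimvf.
apply/eqP; rewrite -(eqr_nat K) natr_sum -mxtrace1.
under eq_bigr => i _ do rewrite -mxtrace1.
have mx_ext m1 m2 (A B : 'M[K]_(m1, m2)) : (forall u : 'rV_m1, u *m A = u *m B) -> A = B.
  by move=> AB; apply/row_matrixP => i; rewrite !rowE.
have ts i : linear_mx (t i) *m linear_mx (s i) = 1%:M.
  by apply: mx_ext => u; rewrite -[u]r2vK mulmxA !mul_linear_mx tK mulmx1.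
have sts : \sum_i linear_mx (s i) *m linear_mx (t i) = 1%:M.
  apply: mx_ext => u; rewrite -[u]r2vK mulmx1 mulmx_sumr.
  under eq_bigr => i _ do rewrite mulmxA !mul_linear_mx.
  by rewrite -linear_sum sumK.
rewrite -sts raddf_sum; apply/eqP; apply: eq_bigr => i _ /=.
by rewrite mxtrace_mulC ts.
Qed.

Lemma dim_bij (U V : vectType K) (f : {linear U -> V}) (g : {linear V -> U}) :
  cancel f g -> cancel g f -> \dim {:U} = \dim {:V}.
Proof.
move=> fK gK.
have := @dim_biproduct V 1 (fun=> U) (fun=> g) (fun=> f).
by rewrite !big_ord1 => ->// v; rewrite big_ord1 gK.
Qed.

End LinearDimension.

Section LinearCategoryFacts.
Variables (K : fieldType) (C : linearCategory K).
Implicit Types X Y Z : C.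

Lemma compDl X Y Z (g g' : hom Y Z) (f : hom X Y) : (g + g') ∘ f = g ∘ f + g' ∘ f.
Proof. by have := comp_linearl 1 g g' f; rewrite !scale1r. Qed.

Lemma compDr X Y Z (g : hom Y Z) (f f' : hom X Y) : g ∘ (f + f') = g ∘ f + g ∘ f'.
Proof. by have := comp_linearr 1 g f f'; rewrite !scale1r. Qed.

Lemma comp0l X Y Z (f : hom X Y) : (0 : hom Y Z) ∘ f = 0.
Proof. by apply: (addrI (0 ∘ f)); rewrite -compDl !addr0. Qed.

Lemma comp0r X Y Z (g : hom Y Z) : g ∘ (0 : hom X Y) = 0.
Proof. by apply: (addrI (g ∘ 0)); rewrite -compDr !addr0. Qed.

Lemma compZl X Y Z a (g : hom Y Z) (f : hom X Y) : (a *: g) ∘ f = a *: (g ∘ f).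
Proof. by have := comp_linearl a g 0 f; rewrite comp0l !addr0. Qed.

Lemma compZr X Y Z a (g : hom Y Z) (f : hom X Y) : g ∘ (a *: f) = a *: (g ∘ f).
Proof. by have := comp_linearr a g f 0; rewrite comp0r !addr0. Qed.

Lemma compNl X Y Z (g : hom Y Z) (f : hom X Y) : (- g) ∘ f = - (g ∘ f).
Proof. by rewrite -scaleN1r compZl scaleN1r. Qed.

Lemma compNr X Y Z (g : hom Y Z) (f : hom X Y) : g ∘ (- f) = - (g ∘ f).
Proof. by rewrite -scaleN1r compZr scaleN1r. Qed.

Lemma comp_suml X Y Z n (g : 'I_n -> hom Y Z) (f : hom X Y) :
  (\sum_i g i) ∘ f = \sum_i g i ∘ f.
Proof. exact: (big_morph (fun g => g ∘ f) (fun g g' => compDl g g' f) (comp0l Z f)). Qed.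

Lemma comp_sumr X Y Z n (g : hom Y Z) (f : 'I_n -> hom X Y) :
  g ∘ (\sum_i f i) = \sum_i g ∘ f i.
Proof. exact: (big_morph (fun f => g ∘ f) (compDr g) (comp0r X g)). Qed.

Definition postcomp X Y Z (g : hom Y Z) (f : hom X Y) := g ∘ f.
Definition precomp X Y Z (f : hom X Y) (g : hom Y Z) := g ∘ f.

HB.instance Definition _ X Y Z (g : hom Y Z) :=
  GRing.isLinear.Build K (hom X Y) (hom X Z) _ (postcomp g)
    (fun a => comp_linearr a g).
HB.instance Definition _ X Y Z (f : hom X Y) :=
  GRing.isLinear.Build K (hom Y Z) (hom X Z) _ (precomp f)
    (fun a g g' => comp_linearl a g g' f).

Lemma iso_id X : is_iso (idm X).
Proof. by exists (idm X); rewrite comp_idl. Qed.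

Lemma iso_comp X Y Z (g : hom Y Z) (f : hom X Y) : is_iso g -> is_iso f -> is_iso (g ∘ f).
Proof.
move=> [g' [g'g gg']] [f' [f'f ff']]; exists (f' ∘ g'); split.
  by rewrite -compA (compA g') g'g comp_idl.
by rewrite -compA (compA f) ff' comp_idl.
Qed.

Lemma isomorphic_refl X : isomorphic X X.
Proof. by exists (idm X); exact: iso_id. Qed.

Lemma isomorphic_sym X Y : isomorphic X Y -> isomorphic Y X.
Proof. by move=> [f [g [gf fg]]]; exists g; exists f. Qed.

Lemma isomorphic_trans X Y Z : isomorphic X Y -> isomorphic Y Z -> isomorphic X Z.
Proof. by move=> [f fi] [g gi]; exists (g ∘ f); exact: iso_comp. Qed.

Lemma is_zero_id X : idm X = 0 -> is_zero X.
Proof.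
move=> id0; split=> Y f; first by rewrite -[f]comp_idr id0 comp0r.
by rewrite -[f]comp_idl id0 comp0l.
Qed.

Lemma isomorphic_sum X Y : isomorphic Y X -> is_direct_sum (fun _ : 'I_1 => Y) X.
Proof.
move=> [f [g [gf fg]]]; exists (fun=> f), (fun=> g); split=> // [i j|].
  by rewrite !ord1.
by rewrite big_ord1.
Qed.

End LinearCategoryFacts.

(** * Schur's lemma and decomposition into simple objects *)

Section Semisimple.
Import VectorInternalTheory.
Variables (K : numClosedFieldType) (C : linearCategory K).
Hypothesis C_ab : abelian_category C.
Hypothesis C_ss : semisimple_category C.
Implicit Types X Y Z : C.

Local Notation dimhom X Y := (\dim {: hom X Y}).

Lemma dimhom_suml n (Y : 'I_n -> C) X Z : is_direct_sum Y X ->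
  dimhom X Z = (\sum_i dimhom (Y i) Z)%N.
Proof.
move=> [inj [prj [pi pij sum1]]].
apply: (@dim_biproduct _ _ _ _ (fun i => precomp (inj i)) (fun i => precomp (prj i))) => [i f | f].
  by rewrite /= /precomp -compA pi comp_idr.
by under eq_bigr => i _ do rewrite /= /precomp -compA; rewrite -comp_sumr sum1 comp_idr.
Qed.

Lemma dimhom_sumr n (Y : 'I_n -> C) X Z : is_direct_sum Y X ->
  dimhom Z X = (\sum_i dimhom Z (Y i))%N.
Proof.
move=> [inj [prj [pi pij sum1]]].
apply: (@dim_biproduct _ _ _ _ (fun i => postcomp (prj i)) (fun i => postcomp (inj i))) => [i f | f].
  by rewrite /= /postcomp compA pi comp_idl.
by under eq_bigr => i _ do rewrite /= /postcomp compA; rewrite -comp_suml sum1 comp_idl.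
Qed.

Lemma dimhom_isol X X' Z : isomorphic X X' -> dimhom X Z = dimhom X' Z.
Proof. by move/isomorphic_sum/dimhom_suml => ->; rewrite big_ord1. Qed.

Lemma dimhom_isor X X' Z : isomorphic X X' -> dimhom Z X = dimhom Z X'.
Proof. by move/isomorphic_sum/dimhom_sumr => ->; rewrite big_ord1. Qed.

(** Schur's lemma: the kernel of [f] is zero or all of [X], and the latter would make [f] zero. So
    [f] is mono, and simplicity of [Y] makes it an isomorphism. *)
Lemma simple_hom_iso X Y (f : hom X Y) :
  simple_object X -> simple_object Y -> f != 0 -> is_iso f.
Proof.
move=> sX sY f0; have [_ ker _ _ _] := C_ab.
have [Z [k [fk kP]]] := ker _ _ f.
have k_mono : is_mono k.
  move=> W g h kgh; have [|u [_ uP]] := kP W (k ∘ g).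
    by rewrite compA fk comp0l.
  by rewrite (uP g) // (uP h).
case: (sX.2 _ _ k_mono) => [zZ|[k' [k'k kk']]]; last first.
  by case/eqP: f0; rewrite -[f]comp_idr -kk' compA fk comp0l.
have f_mono : is_mono f.
  move=> W g h fgh; apply/eqP; rewrite -subr_eq0; apply/eqP.
  have [|u [<- _]] := kP W (g - h); first by rewrite compDr compNr fgh subrr.
  by rewrite (zZ.2 _ u) comp0r.
case: (sY.2 _ _ f_mono) => // zX; by case: (sX.1).
Qed.

Lemma simple_iso X Y : isomorphic X Y -> simple_object X -> simple_object Y.
Proof.
move=> [f [g [gf fg]]] [nzX sX]; split.
  move=> [zY _]; apply: nzX; apply: is_zero_id; rewrite -gf.
  by rewrite -[g]comp_idr (zY _ (idm Y)) comp0r comp0l.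
move=> Z h h_mono; have gh_mono : is_mono (g ∘ h).
  move=> W u v /(congr1 (comp f)); rewrite !compA fg !comp_idl; exact: h_mono.
case: (sX _ _ gh_mono) => [|gh_iso]; [by left | right].
have -> : h = f ∘ (g ∘ h) by rewrite compA fg comp_idl.
by apply: iso_comp => //; exists g.
Qed.

Lemma simple_id_neq0 X : simple_object X -> idm X != 0.
Proof. by move=> [nz _]; apply/eqP => /is_zero_id. Qed.

Lemma dimhom_gt0 X Y (f : hom X Y) : f != 0 -> (0 < dimhom X Y)%N.
Proof.
rewrite lt0n dimv_eq0; apply: contraNN => /eqP d0.
by rewrite -memv0 -d0 memvf.
Qed.

(** Let [a] be an eigenvalue of composition with [f] on End(X). Then [f - a *: idm X] kills a
    nonzero endomorphism, so it is not invertible and Schur's lemma makes it zero. *)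
Lemma simple_end X (f : hom X X) : simple_object X -> exists a, f = a *: idm X.
Proof.
move=> sX.
pose A := linear_mx (postcomp f : {linear hom X X -> hom X X}).
have dpos : (0 < dim (hom X X))%N.
  by rewrite -dimvf; exact: dimhom_gt0 (simple_id_neq0 sX).
have /closed_rootP [a] : size (char_poly A) != 1%N.
  by rewrite size_char_poly -lt0n.
rewrite -eigenvalue_root_char => /eigenvalueP [v vA v0].
exists a; apply/eqP; rewrite -subr_eq0; apply: contraT => /(simple_hom_iso sX sX).
move=> [g [gf _]]; case/eqP: v0; apply: (can_inj (@r2vK _ (hom X X))).
rewrite linear0 -[r2v v]comp_idl -gf -compA compDl compNl compZl comp_idl.
have : postcomp f (r2v v) = a *: r2v v.
  by apply: (can_inj v2rK); rewrite -mul_linear_mx linearZ /= !r2vK.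
by rewrite /postcomp => ->; rewrite subrr comp0r.
Qed.

Lemma dim_line (V : vectType K) (v : V) :
  v != 0 -> (forall w, exists a, w = a *: v) -> \dim {:V} = 1%N.
Proof.
move=> v0 gen; have -> : {:V}%VS = <[v]>%VS.
  apply/eqP; rewrite eqEsubv subvf andbT; apply/subvP => w _.
  by have [a ->] := gen w; rewrite memvZ ?memv_line.
by rewrite dim_vline v0.
Qed.

Lemma simple_dimhom X Y : simple_object X -> simple_object Y ->
  isomorphic X Y -> dimhom X Y = 1%N.
Proof.
move=> sX sY [f [g [gf fg]]]; apply: (@dim_line _ f).
  by apply/eqP => f0; have /eqP := simple_id_neq0 sX; rewrite -gf f0 comp0r.
move=> h; have [a ea] := simple_end (g ∘ h) sX; exists a.
by rewrite -[h]comp_idl -fg -compA ea compZr comp_idr.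
Qed.

Lemma dimhom_neq0 X Y : dimhom X Y != 0%N -> exists f : hom X Y, f != 0.
Proof. by rewrite dimv_eq0 -vpick0 => f0; exists (vpick {: hom X Y}). Qed.

Lemma simple_dimhom_iso X Y : simple_object X -> simple_object Y ->
  dimhom X Y != 0%N -> isomorphic X Y.
Proof.
by move=> sX sY /dimhom_neq0 [f /(simple_hom_iso sX sY) fi]; exists f.
Qed.

Lemma simple_dimhom_sym X Y : simple_object X -> simple_object Y ->
  dimhom X Y = dimhom Y X.
Proof.
move=> sX sY.
have [e|/(simple_dimhom_iso sX sY) XY] := eqVneq (dimhom X Y) 0%N; last first.
  by rewrite !simple_dimhom //; exact: isomorphic_sym.
have [->|/(simple_dimhom_iso sY sX)/isomorphic_sym XY] := eqVneq (dimhom Y X) 0%N; first by [].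
by rewrite simple_dimhom in e.
Qed.

Lemma dimhom_sym X Y : dimhom X Y = dimhom Y X.
Proof.
have [n [X' [sX dX]]] := C_ss X; have [m [Y' [sY dY]]] := C_ss Y.
rewrite (dimhom_suml _ dX) (dimhom_sumr _ dX); apply: eq_bigr => i _.
rewrite (dimhom_sumr _ dY) (dimhom_suml _ dY); apply: eq_bigr => j _.
exact: simple_dimhom_sym.
Qed.

Lemma direct_sum1_iso (Y : 'I_1 -> C) X : is_direct_sum Y X -> isomorphic (Y ord0) X.
Proof.
move=> [inj [prj [pi _ sum1]]]; exists (inj ord0), (prj ord0).
by rewrite pi; split=> //; rewrite -sum1 big_ord1.
Qed.

Lemma direct_sum_iso n (Y Y' : 'I_n -> C) X : (forall i, isomorphic (Y i) (Y' i)) ->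
  is_direct_sum Y X -> is_direct_sum Y' X.
Proof.
move=> YY' [inj [prj [pi pij sum1]]].
have [f fP] : exists f : forall i, hom (Y i) (Y' i), forall i, is_iso (f i).
  exact: (fin_all_exists (U := fun i => hom (Y i) (Y' i)) YY').
have [g gP] : exists g : forall i, hom (Y' i) (Y i),
    forall i, g i ∘ f i = idm (Y i) /\ f i ∘ g i = idm (Y' i).
  exact: (fin_all_exists (U := fun i => hom (Y' i) (Y i)) fP).
exists (fun i => inj i ∘ g i), (fun i => f i ∘ prj i); split.
- by move=> i; rewrite -compA (compA (prj i)) pi comp_idl (gP i).2.
- by move=> i j ij; rewrite -compA (compA (prj i)) pij // comp0l comp0r.
- rewrite -sum1; apply: eq_bigr => i _.
  by rewrite -compA (compA (g i)) (gP i).1 comp_idl.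
Qed.

(** Each simple summand contributes at least 1 to the dimension of End(X), so there is exactly one
    summand. *)
Lemma simple_of_dimhom1 X : dimhom X X = 1%N -> simple_object X.
Proof.
have [n [Y [sY dY]]] := C_ss X; rewrite (dimhom_suml _ dY) => dX.
have n1 : (n <= 1)%N.
  rewrite -dX -[X in (X <= _)%N]card_ord -sum1_card; apply: leq_sum => i _.
  rewrite (dimhom_sumr _ dY) (bigD1 i) //= simple_dimhom ?leq_addr //.
  exact: isomorphic_refl.
case: n n1 Y sY dY dX => [|[|//]] _ Y sY dY; first by rewrite big_ord0.
by move=> _; apply: simple_iso (direct_sum1_iso dY) (sY ord0).
Qed.

Section Representatives.
Variables (r : nat) (X_ : 'I_r -> C).
Hypothesis X_rep : simple_representatives X_.

Lemma rep_simple i : simple_object (X_ i).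
Proof. by case: X_rep. Qed.

Lemma rep_dimhom i j : dimhom (X_ i) (X_ j) = (i == j) :> nat.
Proof.
case: eqP => [->|ij].
  by rewrite simple_dimhom //; [exact: rep_simple | exact: rep_simple | exact: isomorphic_refl].
apply/eqP; apply: contra_notT ij => /simple_dimhom_iso.
by case: X_rep => _ inj _ h; apply: inj; apply: h; exact: rep_simple.
Qed.

Lemma rep_decomposition Y : exists n (s : 'I_n -> 'I_r),
  is_direct_sum (X_ \o s) Y /\ forall k, dimhom (X_ k) Y = (\sum_i (k == s i))%N.
Proof.
have [n [Z [sZ dZ]]] := C_ss Y; exists n.
have [s sP] : exists s : 'I_n -> 'I_r, forall i, isomorphic (Z i) (X_ (s i)).
  apply: (fin_all_exists (U := fun=> 'I_r) (P := fun i j => isomorphic (Z i) (X_ j))) => i.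
  by case: X_rep => _ _ /(_ _ (sZ i)).
have dsum : is_direct_sum (X_ \o s) Y by apply: direct_sum_iso dZ.
exists s; split=> // k; rewrite (dimhom_sumr _ dsum); apply: eq_bigr => i _.
exact: rep_dimhom.
Qed.

(** The universal property of the Grothendieck group: an additive invariant is determined by its
    values on simple objects. *)
Lemma additive_decomposition (A : nmodType) (phi : C -> A) :
  (forall n (Y : 'I_n -> C) Z, is_direct_sum Y Z -> phi Z = \sum_i phi (Y i)) ->
  forall Y, phi Y = \sum_k phi (X_ k) *+ dimhom (X_ k) Y.
Proof.
move=> phi_sum Y; have [n [s [dY mult]]] := rep_decomposition Y.
rewrite (phi_sum _ _ _ dY); under [RHS]eq_bigr => k _ do rewrite mult -sumrMnr.
rewrite exchange_big; apply: eq_bigr => i _ /=.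
by rewrite (bigD1 (s i)) //= eqxx big1 ?addr0 // => k /negPf ->.
Qed.

Lemma rep_index Y : dimhom Y Y = 1%N -> exists i, isomorphic Y (X_ i).
Proof. by move/simple_of_dimhom1; case: X_rep => _ _; apply. Qed.

End Representatives.
End Semisimple.

(** * Morphisms with a tail *)

Notation "X ◁ f" := (tensm (idm X) f) (at level 38, left associativity) : cat_scope.
Notation "f ▷ Z" := (tensm f (idm Z)) (at level 38, left associativity) : cat_scope.

Section Chains.
Variables (K : fieldType) (C : linearCategory K).
Implicit Types W X Y Z : C.

(** Composites are kept associated to the right; this lemma and the next two rewrite the head of
    such a composite while its tail [r] stays untouched. *)
Lemma ch2 X Y Z (g : hom Y Z) (f : hom X Y) k : g ∘ f = k ->
  forall W (r : hom W X), g ∘ (f ∘ r) = k ∘ r.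
Proof. by move=> <- W r; rewrite compA. Qed.

Lemma ch3 X Y Z V (g : hom Y Z) (f : hom X Y) (h : hom V X) k : g ∘ (f ∘ h) = k ->
  forall W (r : hom W V), g ∘ (f ∘ (h ∘ r)) = k ∘ r.
Proof. by move=> <- W r; rewrite !compA. Qed.

Lemma chI X Y (g : hom Y X) (f : hom X Y) : g ∘ f = idm X ->
  forall W (r : hom W X), g ∘ (f ∘ r) = r.
Proof. by move=> e W r; rewrite compA e comp_idl. Qed.

Lemma cancel_r X Y Z (g : hom X Y) (g' : hom Y X) (f f' : hom Y Z) :
  g ∘ g' = idm Y -> f ∘ g = f' ∘ g -> f = f'.
Proof. by move=> e h; rewrite -[f]comp_idr -[f']comp_idr -e !compA h. Qed.

Lemma cancel_l X Y Z (g : hom Y Z) (g' : hom Z Y) (f f' : hom X Y) :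
  g' ∘ g = idm Y -> g ∘ f = g ∘ f' -> f = f'.
Proof. by move=> e h; rewrite -[f]comp_idl -[f']comp_idl -e -!compA h. Qed.

End Chains.

Section Monoidal.
Variables (K : fieldType) (C : monoidalCategory K).
Implicit Types U V W X Y Z : C.
Local Notation "1" := (unit_obj C) : cat_scope.
Local Notation α X Y Z := (assoc X Y Z).
Local Notation α' X Y Z := (assoc_inv X Y Z).

Lemma wl_comp X Y Z W (g : hom Y Z) (f : hom W Y) : X ◁ (g ∘ f) = (X ◁ g) ∘ (X ◁ f).
Proof. by rewrite -tensm_comp comp_idl. Qed.

Lemma wr_comp X Y Z W (g : hom Y Z) (f : hom W Y) : (g ∘ f) ▷ X = (g ▷ X) ∘ (f ▷ X).
Proof. by rewrite -tensm_comp comp_idl. Qed.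

Lemma exch X X' Y Y' (f : hom X X') (g : hom Y Y') :
  (f ▷ Y') ∘ (X ◁ g) = (X' ◁ g) ∘ (f ▷ Y).
Proof. by rewrite -!tensm_comp !comp_idl !comp_idr. Qed.

Lemma wl_id X Y : X ◁ idm Y = idm (X ⊗ Y). Proof. exact: tensm_id. Qed.
Lemma wr_id X Y : idm X ▷ Y = idm (X ⊗ Y). Proof. exact: tensm_id. Qed.

Lemma wl_inv X Y Z (g : hom Y Z) (f : hom Z Y) : g ∘ f = idm _ -> (X ◁ g) ∘ (X ◁ f) = idm _.
Proof. by rewrite -wl_comp => ->; rewrite wl_id. Qed.

Lemma wr_inv X Y Z (g : hom Y Z) (f : hom Z Y) : g ∘ f = idm _ -> (g ▷ X) ∘ (f ▷ X) = idm _.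
Proof. by rewrite -wr_comp => ->; rewrite wr_id. Qed.

Lemma wl2 Y Y' Z V (g : hom Y Z) (f : hom V Y) (g' : hom Y' Z) (f' : hom V Y') :
  g ∘ f = g' ∘ f' -> forall X W (r : hom W (X ⊗ V)),
  (X ◁ g) ∘ ((X ◁ f) ∘ r) = (X ◁ g') ∘ ((X ◁ f') ∘ r).
Proof. by move=> e X W r; rewrite !compA -!wl_comp e. Qed.

Lemma wl1 Y Z V (g : hom Y Z) (f : hom V Y) k :
  g ∘ f = k -> forall X W (r : hom W (X ⊗ V)),
  (X ◁ g) ∘ ((X ◁ f) ∘ r) = (X ◁ k) ∘ r.
Proof. by move=> e X W r; rewrite !compA -!wl_comp e. Qed.

Lemma wlI Y Z (g : hom Y Z) (f : hom Z Y) :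
  g ∘ f = idm Z -> forall X W (r : hom W (X ⊗ Z)), (X ◁ g) ∘ ((X ◁ f) ∘ r) = r.
Proof. by move=> e X W r; rewrite (wl1 e) wl_id comp_idl. Qed.

Lemma assoc_nat1 X X' Y Z (f : hom X X') :
  α X' Y Z ∘ ((f ▷ Y) ▷ Z) = (f ▷ (Y ⊗ Z)) ∘ α X Y Z.
Proof. by rewrite assoc_nat tensm_id. Qed.

Lemma assoc_nat2 X Y Y' Z (f : hom Y Y') :
  α X Y' Z ∘ ((X ◁ f) ▷ Z) = (X ◁ (f ▷ Z)) ∘ α X Y Z.
Proof. exact: assoc_nat. Qed.

Lemma assoc_nat3 X Y Z Z' (f : hom Z Z') :
  α X Y Z' ∘ ((X ⊗ Y) ◁ f) = (X ◁ (Y ◁ f)) ∘ α X Y Z.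
Proof. by rewrite -assoc_nat tensm_id. Qed.

Lemma inv_nat X Y X' Y' (a : hom X Y) (a' : hom Y X) (b : hom X' Y') (b' : hom Y' X')
    (f : hom X X') (g : hom Y Y') :
  a ∘ a' = idm _ -> b' ∘ b = idm _ -> b ∘ f = g ∘ a -> b' ∘ g = f ∘ a'.
Proof.
move=> aa bb e; rewrite -[g]comp_idr -aa (compA g) -e -compA (chI bb) //.
Qed.

Lemma assocV_nat1 X X' Y Z (f : hom X X') :
  α' X' Y Z ∘ (f ▷ (Y ⊗ Z)) = ((f ▷ Y) ▷ Z) ∘ α' X Y Z.
Proof. exact: inv_nat (assocVK _ _ _) (assocK _ _ _) (assoc_nat1 _ _ _). Qed.

Lemma assocV_nat2 X Y Y' Z (f : hom Y Y') :
  α' X Y' Z ∘ (X ◁ (f ▷ Z)) = ((X ◁ f) ▷ Z) ∘ α' X Y Z.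
Proof. exact: inv_nat (assocVK _ _ _) (assocK _ _ _) (assoc_nat2 _ _ _). Qed.

Lemma assocV_nat3 X Y Z Z' (f : hom Z Z') :
  α' X Y Z' ∘ (X ◁ (Y ◁ f)) = ((X ⊗ Y) ◁ f) ∘ α' X Y Z.
Proof. exact: inv_nat (assocVK _ _ _) (assocK _ _ _) (assoc_nat3 _ _ _). Qed.

Lemma lunitV_nat X Y (f : hom X Y) : lunit_inv Y ∘ f = (1 ◁ f) ∘ lunit_inv X.
Proof. exact: inv_nat (lunitVK _) (lunitK _) (lunit_nat _). Qed.

Lemma pentagon1 X Y Z W :
  α X Y (Z ⊗ W) ∘ α (X ⊗ Y) Z W =
  (X ◁ α Y Z W) ∘ (α X (Y ⊗ Z) W ∘ (α X Y Z ▷ W)).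
Proof. by rewrite pentagon compA. Qed.

Lemma pentagon2 X Y Z W :
  (X ◁ α' Y Z W) ∘ α X Y (Z ⊗ W) =
  α X (Y ⊗ Z) W ∘ ((α X Y Z ▷ W) ∘ α' (X ⊗ Y) Z W).
Proof.
apply: (cancel_r (assocVK (X ⊗ Y) Z W)); rewrite -!compA pentagon1 assocK comp_idr.
by rewrite (chI (wl_inv _ (assocK _ _ _))).
Qed.

Lemma pentagon3 X Y Z W :
  α' (X ⊗ Y) Z W ∘ (α' X Y (Z ⊗ W) ∘ (X ◁ α Y Z W)) =
  (α' X Y Z ▷ W) ∘ α' X (Y ⊗ Z) W.
Proof.
apply: (cancel_l (assocK (X ⊗ Y) Z W)); rewrite (chI (assocVK _ _ _)).
apply: (cancel_l (assocK X Y (Z ⊗ W))); rewrite (chI (assocVK _ _ _)).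
rewrite (ch2 (pentagon1 _ _ _ _)) -!compA (chI (wr_inv _ (assocVK _ _ _))).
by rewrite assocVK comp_idr.
Qed.

Lemma triangle2 X Y : (X ◁ lunit Y) = (runit X ▷ Y) ∘ α' X 1 Y.
Proof. by rewrite -triangle -compA assocVK comp_idr. Qed.

Lemma triangleV X Y : α' X 1 Y ∘ (X ◁ lunit_inv Y) = runit_inv X ▷ Y.
Proof.
apply: (cancel_l (assocK _ _ _)); rewrite (chI (assocVK _ _ _)).
apply: (cancel_l (wl_inv X (lunitK Y))); rewrite (ch2 (triangle _ _)).
by rewrite (wl_inv _ (lunitVK _)) (wr_inv _ (runitVK _)).
Qed.

Lemma wl1_inj X Y (f g : hom X Y) : 1 ◁ f = 1 ◁ g -> f = g.
Proof.
move=> e; apply: (cancel_r (lunitVK X)).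
by rewrite -!lunit_nat e.
Qed.

(** Kelly's argument: after tensoring with the unit on the left, the identity follows from the
    pentagon and two triangles. *)
Lemma lunit_tens X Y : lunit (X ⊗ Y) ∘ α 1 X Y = lunit X ▷ Y.
Proof.
apply: wl1_inj; rewrite wl_comp.
apply: (cancel_r (assocVK _ _ _)); apply: (cancel_r (wr_inv Y (assocVK _ _ _))).
rewrite -!compA -pentagon1 (ch2 (triangle _ _)) -assoc_nat1.
by rewrite (ch2 (esym (assoc_nat2 _ _ _))) -compA -wr_comp triangle.
Qed.

Lemma lunitV_tens X Y : α 1 X Y ∘ (lunit_inv X ▷ Y) = lunit_inv (X ⊗ Y).
Proof.
apply: (cancel_l (lunitK _)); rewrite (ch2 (lunit_tens _ _)) lunitVK.
exact: wr_inv (lunitVK _).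
Qed.

(* Morphisms are handled through their action on a tail [Z]: a pairing
   [A ⊗ B -> 1] acts as [A ⊗ (B ⊗ Z) -> Z], so that associators disappear.
   These operations are locked because rewriting with [compA] would otherwise
   see through them. *)
Definition cap0 A (e : hom A 1) Z : hom (A ⊗ Z) Z := locked (lunit Z ∘ (e ▷ Z)).
Definition cap A B (e : hom (A ⊗ B) 1) Z : hom (A ⊗ (B ⊗ Z)) Z :=
  locked (cap0 e Z ∘ α' A B Z).
Definition cup A B (c : hom 1 (A ⊗ B)) Z : hom Z (A ⊗ (B ⊗ Z)) :=
  locked (α A B Z ∘ ((c ▷ Z) ∘ lunit_inv Z)).
Definition act A B A' B' (f : hom (A ⊗ B) (A' ⊗ B')) Z :
    hom (A ⊗ (B ⊗ Z)) (A' ⊗ (B' ⊗ Z)) :=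
  locked (α A' B' Z ∘ ((f ▷ Z) ∘ α' A B Z)).

Lemma cap0E A (e : hom A 1) Z : cap0 e Z = lunit Z ∘ (e ▷ Z).
Proof. by rewrite /cap0 -lock. Qed.

Lemma capE A B (e : hom (A ⊗ B) 1) Z : cap e Z = cap0 e Z ∘ α' A B Z.
Proof. by rewrite /cap -lock. Qed.

Lemma cupE A B (c : hom 1 (A ⊗ B)) Z : cup c Z = α A B Z ∘ ((c ▷ Z) ∘ lunit_inv Z).
Proof. by rewrite /cup -lock. Qed.

Lemma actE A B A' B' (f : hom (A ⊗ B) (A' ⊗ B')) Z :
  act f Z = α A' B' Z ∘ ((f ▷ Z) ∘ α' A B Z).
Proof. by rewrite /act -lock. Qed.

Lemma cap0_nat A (e : hom A 1) Z Z' (f : hom Z Z') :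
  cap0 e Z' ∘ (A ◁ f) = f ∘ cap0 e Z.
Proof. by rewrite !cap0E -compA exch (ch2 (lunit_nat _)) -compA. Qed.

Lemma cap_nat A B (e : hom (A ⊗ B) 1) Z Z' (f : hom Z Z') :
  cap e Z' ∘ (A ◁ (B ◁ f)) = f ∘ cap e Z.
Proof. by rewrite !capE -compA assocV_nat3 (ch2 (cap0_nat _ _)) -compA. Qed.

Lemma cup_nat A B (c : hom 1 (A ⊗ B)) Z Z' (f : hom Z Z') :
  cup c Z' ∘ f = (A ◁ (B ◁ f)) ∘ cup c Z.
Proof.
by rewrite !cupE -!compA lunitV_nat (ch2 (exch _ _)) -compA (ch2 (assoc_nat3 _ _ _)) -!compA.
Qed.

Lemma act_nat A B A' B' (g : hom (A ⊗ B) (A' ⊗ B')) Z Z' (f : hom Z Z') :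
  act g Z' ∘ (A ◁ (B ◁ f)) = (A' ◁ (B' ◁ f)) ∘ act g Z.
Proof.
by rewrite !actE -!compA assocV_nat3 (ch2 (exch _ _)) -compA (ch2 (assoc_nat3 _ _ _)) -!compA.
Qed.

Lemma act_comp A B A' B' A'' B'' (g : hom (A' ⊗ B') (A'' ⊗ B''))
    (f : hom (A ⊗ B) (A' ⊗ B')) Z : act (g ∘ f) Z = act g Z ∘ act f Z.
Proof. by rewrite !actE -!compA (chI (assocK _ _ _)) wr_comp -!compA. Qed.

Lemma act_wr A A' B (f : hom A A') Z : act (f ▷ B) Z = f ▷ (B ⊗ Z).
Proof. by rewrite !actE (ch2 (assoc_nat1 _ _ _)) -compA assocVK comp_idr. Qed.

Lemma act_wl A B B' (f : hom B B') Z : act (A ◁ f) Z = A ◁ (f ▷ Z).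
Proof. by rewrite !actE (ch2 (assoc_nat2 _ _ _)) -compA assocVK comp_idr. Qed.

Lemma cap_act A B A' B' (e : hom (A' ⊗ B') 1) (f : hom (A ⊗ B) (A' ⊗ B')) Z :
  cap (e ∘ f) Z = cap e Z ∘ act f Z.
Proof. by rewrite !capE !cap0E !actE -!compA (chI (assocK _ _ _)) wr_comp -!compA. Qed.

Lemma cup_act A B A' B' (c : hom 1 (A ⊗ B)) (f : hom (A ⊗ B) (A' ⊗ B')) Z :
  cup (f ∘ c) Z = act f Z ∘ cup c Z.
Proof. by rewrite !cupE !actE -!compA (chI (assocK _ _ _)) wr_comp -!compA. Qed.

Lemma cap_tens A B (e : hom (A ⊗ B) 1) V Z :
  cap e (V ⊗ Z) ∘ ((A ◁ α B V Z) ∘ α A (B ⊗ V) Z) = cap e V ▷ Z.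
Proof.
rewrite !capE !cap0E !wr_comp -!compA -lunit_tens -!compA.
rewrite (ch2 (assoc_nat1 _ _ _)) -!compA; congr (_ ∘ (_ ∘ _)).
apply: (cancel_l (assocK _ _ _)); rewrite (chI (assocVK _ _ _)).
by rewrite (ch2 (pentagon1 _ _ _ _)) -!compA (wr_inv _ (assocVK _ _ _)) comp_idr.
Qed.

Lemma cup_tens A B (c : hom 1 (A ⊗ B)) V Z :
  (A ◁ α B V Z) ∘ (α A (B ⊗ V) Z ∘ (cup c V ▷ Z)) = cup c (V ⊗ Z).
Proof.
rewrite !cupE !wr_comp -lunitV_tens.
rewrite (ch2 (esym (assoc_nat1 _ _ _))) -!compA.
by rewrite (ch2 (pentagon1 _ _ _ _)) -!compA.
Qed.

(** The first duality equation tensored with [Z]; the triangle axiom absorbs the unit standing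
    before the tail. *)
Lemma zigzag1 X X' (e : hom (X' ⊗ X) 1) (c : hom 1 (X ⊗ X')) Z : is_left_dual e c ->
  (X ◁ cap e Z) ∘ cup c (X ⊗ Z) = idm _.
Proof.
move=> [zz _]; rewrite -cup_tens !capE wl_comp -compA.
rewrite (chI (wl_inv _ (assocK _ _ _))) !cap0E wl_comp -compA.
rewrite (ch2 (esym (assoc_nat2 _ _ _))) -!compA (ch2 (triangle _ _)) -wr_comp -wr_comp.
by rewrite -[RHS]wr_id; congr (_ ▷ Z); rewrite -[RHS]zz !cupE -!compA.
Qed.

Lemma zigzag2 X X' (e : hom (X' ⊗ X) 1) (c : hom 1 (X ⊗ X')) Z : is_left_dual e c ->
  cap e (X' ⊗ Z) ∘ (X' ◁ cup c Z) = idm _.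
Proof.
move=> [_ zz]; rewrite !cupE.
have -> : cap e (X' ⊗ Z) = (cap e X' ▷ Z) ∘ (α' X' (X ⊗ X') Z ∘ (X' ◁ α' X X' Z)).
  rewrite -cap_tens -[RHS]compA -[X in _ = _ ∘ X]compA (chI (assocVK _ _ _)).
  by rewrite (wl_inv _ (assocVK _ _ _)) comp_idr.
rewrite !wl_comp -!compA (chI (wl_inv _ (assocK _ _ _))).
rewrite (ch2 (assocV_nat2 _ _ _)) -!compA triangleV -!wr_comp.
by rewrite -[RHS]wr_id; congr (_ ▷ Z); rewrite -[RHS]zz !capE !cap0E -!compA.
Qed.

Lemma pentagon4 X Y Z W :
  α' X Y (Z ⊗ W) ∘ ((X ◁ α Y Z W) ∘ α X (Y ⊗ Z) W) =
  α (X ⊗ Y) Z W ∘ (α' X Y Z ▷ W).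
Proof.
apply: (cancel_l (assocK X Y (Z ⊗ W))); rewrite (chI (assocVK _ _ _)).
by rewrite (ch2 (pentagon1 _ _ _ _)) -!compA (wr_inv _ (assocVK _ _ _)) comp_idr.
Qed.

Lemma act_tens A B A' B' (f : hom (A ⊗ B) (A' ⊗ B')) V Z :
  (A' ◁ α B' V Z) ∘ (α A' (B' ⊗ V) Z ∘ (act f V ▷ Z)) =
  act f (V ⊗ Z) ∘ ((A ◁ α B V Z) ∘ α A (B ⊗ V) Z).
Proof.
rewrite !actE !wr_comp -!compA pentagon4.
rewrite (ch3 (esym (pentagon1 _ _ _ _))) -!compA.
by rewrite (ch2 (assoc_nat1 _ _ _)) -!compA.
Qed.

Lemma act_assoc A B A' B' (f : hom (A ⊗ B) (A' ⊗ B')) Z :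
  act f Z ∘ α A B Z = α A' B' Z ∘ (f ▷ Z).
Proof. by rewrite !actE -!compA assocK comp_idr. Qed.

Lemma cap_cap0 A B (e : hom (A ⊗ B) 1) Z : cap0 e Z = cap e Z ∘ α A B Z.
Proof. by rewrite !capE -compA assocK comp_idr. Qed.

Lemma wl_linear X Y Z a (f : hom Y Z) : X ◁ (a *: f) = a *: (X ◁ f).
Proof.
have := tensm_linearr a (idm X) f 0; rewrite !addr0 => ->.
have e0 : tensm (idm X) (0 : hom Y Z) = 0.
  apply: (addrI (tensm (idm X) (0 : hom Y Z))).
  by have := tensm_linearr 1 (idm X) (0 : hom Y Z) 0; rewrite !scale1r !addr0 => <-.
by rewrite e0 addr0.
Qed.

Lemma wr_linear X Y Z a (f : hom Y Z) : (a *: f) ▷ X = a *: (f ▷ X).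
Proof.
have := tensm_linearl a f 0 (idm X); rewrite !addr0 => ->.
have e0 : tensm (0 : hom Y Z) (idm X) = 0.
  apply: (addrI (tensm (0 : hom Y Z) (idm X))).
  by have := tensm_linearl 1 (0 : hom Y Z) 0 (idm X); rewrite !scale1r !addr0 => <-.
by rewrite e0 addr0.
Qed.

Lemma wl_sum X Y Z n (f : 'I_n -> hom Y Z) : X ◁ (\sum_i f i) = \sum_i (X ◁ f i).
Proof.
apply: (big_morph (fun f => X ◁ f)) => [g h|].
  by have := tensm_linearr 1 (idm X) g h; rewrite !scale1r.
by have := wl_linear X 0 (0 : hom Y Z); rewrite !scale0r.
Qed.

Lemma wr_sum X Y Z n (f : 'I_n -> hom Y Z) : (\sum_i f i) ▷ X = \sum_i (f i ▷ X).
Proof.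
apply: (big_morph (fun f => f ▷ X)) => [g h|].
  by have := tensm_linearl 1 g h (idm X); rewrite !scale1r.
by have := wr_linear X 0 (0 : hom Y Z); rewrite !scale0r.
Qed.

End Monoidal.

(** * Transposition and duals of tensor products *)

Section Rigid.
Variables (K : fieldType) (C : rigidCategory K).
Implicit Types U V W X Y Z : C.
Local Notation "1" := (unit_obj C) : cat_scope.
Local Notation α X Y Z := (assoc X Y Z).
Local Notation α' X Y Z := (assoc_inv X Y Z).

(** The image of [m] under the duality bijection between Hom(1, W ⊗ V) and Hom(dual W, V). *)
Definition mate W V (m : hom 1 (W ⊗ V)) : hom (dual W) V :=
  cap (ev W) V ∘ ((dual W ◁ m) ∘ runit_inv (dual W)).

Lemma mate_tens W V (m : hom 1 (W ⊗ V)) Z :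
  mate m ▷ Z = cap (ev W) (V ⊗ Z) ∘ (dual W ◁ cup m Z).
Proof.
rewrite /mate !wr_comp -cap_tens -!compA (ch2 (assoc_nat2 _ _ _)) -!compA.
by rewrite -triangleV (chI (assocVK _ _ _)) cupE !wl_comp.
Qed.

Lemma mate_cup W V (m : hom 1 (W ⊗ V)) Z :
  (W ◁ (mate m ▷ Z)) ∘ cup (coev W) Z = cup m Z.
Proof.
rewrite mate_tens wl_comp -compA -cup_nat compA.
by rewrite (zigzag1 _ (dualP W)) comp_idl.
Qed.

Lemma mate_cap W V U (m : hom 1 (W ⊗ V)) (n : hom (V ⊗ U) 1) Z :
  cap n Z ∘ (mate m ▷ (U ⊗ Z)) =
  cap (ev W) Z ∘ (dual W ◁ ((W ◁ cap n Z) ∘ cup m (U ⊗ Z))).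
Proof. by rewrite mate_tens compA -cap_nat wl_comp compA. Qed.

Section NestedDual.
Variables X Y : C.
Let P := dual Y ⊗ dual X.

(** Nesting the cup of [Y] inside that of [X] presents dual Y ⊗ dual X as a dual of X ⊗ Y. *)
Definition nested_coev : hom 1 ((X ⊗ Y) ⊗ P) :=
  α' X Y P ∘ ((X ◁ cup (coev Y) (dual X)) ∘ coev X).

Definition nested_ev : hom (P ⊗ (X ⊗ Y)) 1 :=
  ev Y ∘ ((dual Y ◁ cap (ev X) Y) ∘ α (dual Y) (dual X) (X ⊗ Y)).

Lemma nested_cup Z :
  α X Y _ ∘ (((X ⊗ Y) ◁ α (dual Y) (dual X) Z) ∘ cup nested_coev Z) =
  (X ◁ cup (coev Y) (dual X ⊗ Z)) ∘ cup (coev X) Z.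
Proof.
rewrite (ch2 (assoc_nat3 _ _ _)) !(cupE nested_coev) /nested_coev !wr_comp -!compA.
rewrite (ch2 (pentagon1 _ _ _ _)) -!compA (chI (wr_inv _ (assocVK _ _ _))).
rewrite (ch2 (assoc_nat2 _ _ _)) -!compA -cupE.
by rewrite -cup_tens !wl_comp -!compA.
Qed.

Lemma nested_cap Z :
  cap nested_ev Z = cap (ev Y) Z ∘ ((dual Y ◁ cap (ev X) (Y ⊗ Z)) ∘
    ((dual Y ◁ (dual X ◁ α X Y Z)) ∘ α (dual Y) (dual X) ((X ⊗ Y) ⊗ Z))).
Proof.
rewrite capE cap0E !wr_comp -!compA (compA (lunit _)) -cap0E cap_cap0 -!compA.
rewrite (ch2 (assoc_nat2 _ _ _)) -!compA -cap_tens !wl_comp -!compA.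
congr (_ ∘ (_ ∘ (_ ∘ _))).
apply: (cancel_r (assocVK _ _ _)); rewrite -!compA assocK comp_idr.
by rewrite -pentagon1.
Qed.

(** Naturality of the cups lets the inner pair cancel by the duality of [Y], then the outer pair by
    that of [X]. *)
Lemma nested_zigzag Z :
  ((X ⊗ Y) ◁ cap nested_ev Z) ∘ cup nested_coev ((X ⊗ Y) ⊗ Z) = idm _.
Proof.
apply: (cancel_l (assocK X Y Z)); rewrite comp_idr.
have cupV := nested_cup ((X ⊗ Y) ⊗ Z).
have -> : cup nested_coev ((X ⊗ Y) ⊗ Z) =
    ((X ⊗ Y) ◁ α' (dual Y) (dual X) _) ∘ (α' X Y _ ∘
      ((X ◁ cup (coev Y) _) ∘ cup (coev X) _)).
  by rewrite -cupV (chI (assocK _ _ _)) (chI (wl_inv _ (assocK _ _ _))).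
rewrite nested_cap !wl_comp -!compA (chI (wl_inv _ (assocVK _ _ _))).
rewrite (ch2 (assoc_nat3 _ _ _)) -!compA (ch2 (assoc_nat3 _ _ _)) -!compA.
rewrite (ch2 (assoc_nat3 _ _ _)) -!compA (chI (assocVK _ _ _)).
rewrite (wl2 (esym (cup_nat _ _))) (wl2 (esym (cup_nat _ _))).
rewrite (wlI (zigzag1 _ (dualP Y))) -cup_nat.
by rewrite (chI (zigzag1 _ (dualP X))).
Qed.

End NestedDual.
End Rigid.

(** * Braiding, traces and loops *)

Section Ribbon.
Variables (K : fieldType) (C : ribbonFusionCategory K).
Implicit Types A B V W X Y Z : C.
Local Notation "1" := (unit_obj C) : cat_scope.
Local Notation α X Y Z := (assoc X Y Z).
Local Notation α' X Y Z := (assoc_inv X Y Z).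
Local Notation β X Y Z := (act (braid X Y) Z).
Local Notation θ := twist.

Lemma act_braidl X X' Y Z (f : hom X X') :
  β X' Y Z ∘ (f ▷ (Y ⊗ Z)) = (Y ◁ (f ▷ Z)) ∘ β X Y Z.
Proof. by rewrite -act_wr -act_comp braid_nat act_comp act_wl. Qed.

Lemma act_braidr X Y Y' Z (f : hom Y Y') :
  β X Y' Z ∘ (X ◁ (f ▷ Z)) = (f ▷ (X ⊗ Z)) ∘ β X Y Z.
Proof. by rewrite -act_wl -act_comp braid_nat act_comp act_wr. Qed.

Lemma act_hexagon1 X A B Z :
  (A ◁ β X B Z) ∘ (β X A (B ⊗ Z) ∘ (X ◁ α A B Z)) = α A B (X ⊗ Z) ∘ β X (A ⊗ B) Z.
Proof.
have braidE : braid X (A ⊗ B) = α' A B X ∘ ((A ◁ braid X B) ∘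
    (α A X B ∘ ((braid X A ▷ B) ∘ α' X A B))).
  apply: (cancel_r (assocVK X A B)); apply: (cancel_l (assocK A B X)).
  rewrite -!compA (chI (assocVK _ _ _)) assocK comp_idr.
  by have := hexagon1 X A B; rewrite -!compA.
rewrite !actE braidE !wr_comp -!compA (ch2 (pentagon1 _ _ _ _)) -!compA.
rewrite (chI (wr_inv _ (assocVK _ _ _))) (ch2 (assoc_nat2 _ _ _)) -!compA.
rewrite !wl_comp -!compA -pentagon3 (ch2 (pentagon2 _ _ _ _)) -!compA.
by rewrite (ch2 (assocV_nat1 _ _ _)) -!compA.
Qed.

Lemma act_hexagon2 X Y W Z :
  (W ◁ α X Y Z) ∘ β (X ⊗ Y) W Z =
  β X W (Y ⊗ Z) ∘ ((X ◁ β Y W Z) ∘ α X Y (W ⊗ Z)).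
Proof.
have braidE : braid (X ⊗ Y) W = α W X Y ∘ ((braid X W ▷ Y) ∘
    (α' X W Y ∘ ((X ◁ braid Y W) ∘ α X Y W))).
  apply: (cancel_r (assocK X Y W)); apply: (cancel_l (assocVK W X Y)).
  rewrite -!compA (chI (assocK _ _ _)) assocVK comp_idr.
  by have := hexagon2 X Y W; rewrite -!compA.
rewrite !actE braidE !wr_comp -!compA.
rewrite (ch3 (esym (pentagon1 _ _ _ _))) -!compA (ch2 (assoc_nat1 _ _ _)) -!compA.
rewrite !wl_comp -!compA pentagon2 (ch2 (esym (assoc_nat2 _ _ _))) -!compA.
by rewrite (ch3 (pentagon4 _ _ _ _)) -!compA.
Qed.

(* The hexagon for X, 1, 1 makes the endomorphism of X given by braiding
   with the unit idempotent; being invertible, it is the identity. *)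
Lemma braid_unit X : lunit X ∘ braid X 1 = runit X.
Proof.
have [b' [b'b bb']] := braid_iso X 1.
have [p [p' [bE p'p]]] : exists p p' : hom X X,
    braid X 1 = lunit_inv X ∘ (p ∘ runit X) /\ p' ∘ p = idm X.
  exists (lunit X ∘ (braid X 1 ∘ runit_inv X)), (runit X ∘ (b' ∘ lunit_inv X)).
  rewrite -!compA runitK comp_idr !(chI (lunitK _)); split=> //.
  by rewrite (chI b'b) runitVK.
suff pp : p ∘ p = p.
  have p1 : p = idm X by rewrite -p'p -{1}[p]comp_idl -{1}p'p -compA pp.
  by rewrite bE p1 comp_idl (chI (lunitVK _)).
have h := hexagon1 X 1 1; move: h; rewrite -!compA => h.
have nat1 : braid X (1 ⊗ 1) = (lunit_inv 1 ▷ X) ∘ (braid X 1 ∘ (X ◁ lunit 1)).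
  by rewrite braid_nat (chI (wr_inv _ (lunitK _))).
rewrite nat1 -!compA triangle (ch2 (lunitV_tens _ _)) in h.
rewrite !bE !wl_comp !wr_comp -!compA (ch2 (lunitV_tens _ _)) in h.
have lV Y Z (f : hom Y Z) W (r : hom W Y) :
    (1 ◁ f) ∘ (lunit_inv Y ∘ r) = lunit_inv Z ∘ (f ∘ r).
  by rewrite compA -lunitV_nat -compA.
rewrite !lV in h; move/(congr1 (comp (lunit _))): h.
rewrite !(chI (lunitVK _)) => /(congr1 (comp (lunit _))).
rewrite !(chI (lunitVK _)) (ch2 (runit_nat _)) -!compA => h.
apply/esym; apply: (cancel_r (runitVK X)); apply: (cancel_r (wr_inv 1 (runitVK X))).
by rewrite -!compA.
Qed.

Lemma cap0_braid A (e : hom A 1) X Z : cap0 e (X ⊗ Z) ∘ β X A Z = X ◁ cap0 e Z.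
Proof.
rewrite !cap0E actE -!compA (ch2 (esym (assoc_nat1 _ _ _))) -!compA.
rewrite (ch2 (lunit_tens _ _)) (ch2 (esym (wr_comp _ _ _))).
rewrite (ch2 (esym (wr_comp _ _ _))) -compA -braid_nat compA braid_unit wr_comp.
by rewrite -!compA -assocV_nat2 wl_comp compA -triangle2.
Qed.

(** A strand crossing both legs of a cap can be pulled off: by the hexagon it crosses A ⊗ B, and
    naturality turns this into a crossing with the unit. *)
Lemma cap_braid A B (e : hom (A ⊗ B) 1) X Z :
  cap e (X ⊗ Z) ∘ ((A ◁ β X B Z) ∘ β X A (B ⊗ Z)) = X ◁ cap e Z.
Proof.
have -> : (A ◁ β X B Z) ∘ β X A (B ⊗ Z) =
    α A B (X ⊗ Z) ∘ (β X (A ⊗ B) Z ∘ (X ◁ α' A B Z)).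
  apply: (cancel_r (wl_inv X (assocVK A B Z))).
  by rewrite -!compA (wl_inv _ (assocK _ _ _)) comp_idr act_hexagon1.
by rewrite !capE -compA (chI (assocK _ _ _)) (ch2 (cap0_braid _ _ _)) wl_comp.
Qed.

(** The pairing of Y with dual Y in this order, built from [ev] by the braiding and the twist;
    closing a cup with it yields [ribbon_trace]. *)
Definition kap Y Z : hom (Y ⊗ (dual Y ⊗ Z)) Z :=
  locked (cap (ev Y ∘ (braid Y (dual Y) ∘ (θ Y ▷ dual Y))) Z).

Lemma kapE Y Z : kap Y Z = cap (ev Y) Z ∘ (β Y (dual Y) Z ∘ (θ Y ▷ (dual Y ⊗ Z))).
Proof. by rewrite /kap -lock cap_act act_comp act_wr. Qed.

Lemma kap_cap Y Z : kap Y Z = cap (ev Y ∘ (braid Y (dual Y) ∘ (θ Y ▷ dual Y))) Z.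
Proof. by rewrite /kap -lock. Qed.

Lemma kap_nat Y Z Z' (f : hom Z Z') :
  kap Y Z' ∘ (Y ◁ (dual Y ◁ f)) = f ∘ kap Y Z.
Proof. by rewrite !kap_cap cap_nat. Qed.

(** [psi] is the transpose of [g]. It slides [g] around a cup by duality and around [kap] by
    naturality of the braiding and the twist. *)
Lemma mate_ex W Y (g : hom W Y) : exists psi : hom (dual Y) (dual W), forall Z,
  (g ▷ (dual W ⊗ Z)) ∘ cup (coev W) Z = (Y ◁ (psi ▷ Z)) ∘ cup (coev Y) Z /\
  kap W Z ∘ (W ◁ (psi ▷ Z)) = kap Y Z ∘ (g ▷ (dual Y ⊗ Z)).
Proof.
pose m : hom 1 (Y ⊗ dual W) := (g ▷ dual W) ∘ coev W.
have mE Z : cup m Z = (g ▷ (dual W ⊗ Z)) ∘ cup (coev W) Z.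
  by rewrite /m cup_act act_wr.
exists (mate m) => Z; split; first by rewrite mate_cup mE.
rewrite !kapE -!compA exch (ch2 (act_braidr _ _ _)) -!compA.
rewrite (ch2 (mate_cap _ _ _)) mE (ch2 (esym (exch _ _))) -!compA (zigzag1 _ (dualP W)).
rewrite comp_idr (ch2 (esym (act_braidl _ _ _))) -!compA.
by rewrite -!wr_comp twist_nat.
Qed.

(** [j] identifies dual (X ⊗ Y) with dual Y ⊗ dual X. The two crossings that [twist_tens] puts into
    the twist of X ⊗ Y serve to pull [Y] off the cap of [X] and then [X] off the cap of [Y]. *)
Lemma nested_dual X Y Z :
  exists j : hom (dual (X ⊗ Y) ⊗ Z) (dual Y ⊗ (dual X ⊗ Z)),
  α X Y _ ∘ (((X ⊗ Y) ◁ j) ∘ cup (coev (X ⊗ Y)) Z) =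
    (X ◁ cup (coev Y) (dual X ⊗ Z)) ∘ cup (coev X) Z /\
  kap (X ⊗ Y) Z = kap X Z ∘ ((X ◁ kap Y (dual X ⊗ Z)) ∘ (α X Y _ ∘ ((X ⊗ Y) ◁ j))).
Proof.
set W := X ⊗ Y; pose P := dual Y ⊗ dual X.
pose psi : hom (dual W) P := mate (nested_coev X Y).
exists (α (dual Y) (dual X) Z ∘ (psi ▷ Z)); split.
  by rewrite wl_comp -compA mate_cup nested_cup.
pose S := dual X ⊗ Z; pose T := dual Y ⊗ S.
pose D := braid Y X ∘ braid X Y.
pose e := ev X ∘ braid X (dual X).
have [G Gdef] : exists G, G = β X (dual Y) (Y ⊗ S) ∘ (X ◁ β Y (dual Y) S) by eexists.
have GE : (dual Y ◁ α X Y S) ∘ β W (dual Y) S = G ∘ α X Y T.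
  by rewrite Gdef act_hexagon2 -!compA.
have eE V : cap e V = cap (ev X) V ∘ β X (dual X) V by rewrite cap_act.
have ex_psi : cap (nested_ev X Y) Z ∘ (psi ▷ (W ⊗ Z)) = cap (ev W) Z.
  by rewrite mate_cap nested_zigzag wl_id comp_idr.
rewrite kapE -ex_psi -!compA (ch2 (esym (act_braidr _ _ _))) -!compA -exch.
rewrite !wl_comp !compA; congr (_ ∘ _); rewrite -!compA.
have twE : θ W = D ∘ tensm (θ X) (θ Y).
  by rewrite /D /W twist_tens -!compA braid_nat (ch2 (braid_nat _ _)) -!compA.
have key : cap (nested_ev X Y) Z ∘ β W P Z =
    cap (ev Y) Z ∘ ((dual Y ◁ (cap e (Y ⊗ Z) ∘ (X ◁ β Y (dual X) Z))) ∘
      (G ∘ (α X Y T ∘ (W ◁ α (dual Y) (dual X) Z)))).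
  rewrite nested_cap -!compA -act_hexagon1.
  rewrite (wl1 (act_hexagon2 _ _ _ _)) !wl_comp -!compA.
  by rewrite (ch2 GE) eE !wl_comp -!compA.
rewrite (ch2 key) -!compA.
have GD : G ∘ act D T = (dual Y ◁ act D S) ∘ G.
  apply: (cancel_r (assocVK X Y T)); rewrite -!compA act_assoc -GE.
  rewrite (ch2 (esym GE)) -compA act_braidl.
  by rewrite !(ch2 (esym (wl_comp _ _ _))) act_assoc.
have tail : α X Y T ∘ ((W ◁ α (dual Y) (dual X) Z) ∘ (θ W ▷ (P ⊗ Z))) =
    act (θ W) T ∘ (α X Y T ∘ (W ◁ α (dual Y) (dual X) Z)).
  by rewrite -exch (ch2 (act_assoc _ _)) -compA.
rewrite tail twE act_comp -!compA (ch2 GD) -!compA.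
rewrite (ch2 (esym (wl_comp _ _ _))) act_comp -!compA.
rewrite (ch3 (cap_braid _ _ _)) wl_comp -!compA (ch2 (cap_nat _ _)) -!compA Gdef -!compA.
rewrite (ch3 (cap_braid _ _ _)) eE !kapE !wl_comp -!compA.
have -> : act (tensm (θ X) (θ Y)) T = (X ◁ (θ Y ▷ T)) ∘ (θ X ▷ (Y ⊗ T)).
  by rewrite -act_wr -act_wl -act_comp -tensm_comp comp_idl comp_idr.
by rewrite (ch2 (exch _ _)) -!compA (ch2 (exch _ _)) -!compA (ch2 (exch _ _)) -!compA.
Qed.

Lemma unit_id_neq0 : idm 1 != 0.
Proof.
apply/eqP => id0; have := fus_unit C; have -> : {: hom 1 1}%VS = 0%VS.
  apply/eqP; rewrite -subv0; apply/subvP => g _.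
  by rewrite -[g]comp_idl id0 comp0l mem0v.
by rewrite dimv0.
Qed.

Lemma unit_scalarE (f : hom 1 1) : f = unit_scalar f *: idm 1.
Proof.
have full : <<[tuple of [:: idm 1]]>>%VS = {: hom 1 1}%VS.
  apply/eqP; rewrite eqEdim subvf span_seq1 dim_vline unit_id_neq0.
  by rewrite fus_unit.
have := @coord_span _ _ _ [tuple of [:: idm 1]] f.
by rewrite full memvf big_ord1; apply.
Qed.

Lemma trace_tail X (f : hom X X) Z :
  kap X Z ∘ ((f ▷ (dual X ⊗ Z)) ∘ cup (coev X) Z) = ribbon_trace f *: idm Z.
Proof.
rewrite kap_cap capE cap0E cupE -!compA.
rewrite (ch2 (assocV_nat1 _ _ _)) -!compA (chI (assocK _ _ _)).
rewrite (ch2 (esym (wr_comp _ _ _))) (ch2 (esym (wr_comp _ _ _))) -!compA.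
rewrite /ribbon_trace; set phi := ev X ∘ _; set psi := ev X ∘ _ ∘ _ ∘ _.
have -> : phi = psi by rewrite /phi /psi wr_comp -!compA.
by rewrite {1}[psi]unit_scalarE wr_linear wr_id compZl comp_idl compZr lunitVK.
Qed.

Lemma nested_trace X Y (f : hom (X ⊗ Y) (X ⊗ Y)) Z :
  kap X Z ∘ ((X ◁ kap Y (dual X ⊗ Z)) ∘ (act f (dual Y ⊗ (dual X ⊗ Z)) ∘
    ((X ◁ cup (coev Y) (dual X ⊗ Z)) ∘ cup (coev X) Z))) =
  ribbon_trace f *: idm Z.
Proof.
have [j [cupj kapj]] := nested_dual X Y Z.
rewrite -(trace_tail f Z) kapj -cupj -!compA; congr (_ ∘ (_ ∘ _)).
by rewrite (ch2 (act_assoc _ _)) -!compA (ch2 (exch _ _)) -compA.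
Qed.

(** The transpose of [f] carries it around the closed loop to the other side of [g]. *)
Lemma trace_cyclic X Y (f : hom X Y) (g : hom Y X) :
  ribbon_trace (g ∘ f) = ribbon_trace (f ∘ g).
Proof.
suff : ribbon_trace (g ∘ f) *: idm 1 = ribbon_trace (f ∘ g) *: idm 1.
  move/eqP; rewrite -subr_eq0 -scalerBl scaler_eq0 (negPf unit_id_neq0) orbF subr_eq0.
  by move/eqP.
have [psi psiP] := mate_ex f; have [e1 e2] := psiP 1.
rewrite -!trace_tail !wr_comp.
rewrite -[(_ ∘ _) ∘ cup _ _ in LHS]compA e1 -[(_ ∘ _) ∘ cup _ _ in RHS]compA.
by rewrite (ch2 (esym e2)) (ch2 (exch _ _)) -!compA.
Qed.

(** The partial trace of [f] over its right factor, computed in the presence of a tail. *)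
Definition ptr A B Y (f : hom (A ⊗ Y) (B ⊗ Y)) Z : hom (A ⊗ Z) (B ⊗ Z) :=
  (B ◁ kap Y Z) ∘ (act f (dual Y ⊗ Z) ∘ (A ◁ cup (coev Y) Z)).

Lemma ptr_nat A B Y (f : hom (A ⊗ Y) (B ⊗ Y)) Z Z' (h : hom Z Z') :
  ptr f Z' ∘ (A ◁ h) = (B ◁ h) ∘ ptr f Z.
Proof.
rewrite /ptr -?compA -wl_comp cup_nat wl_comp (ch2 (act_nat _ _)) -?compA.
by rewrite (wl2 (kap_nat _ _)).
Qed.

Lemma ptr_tens A B Y (f : hom (A ⊗ Y) (B ⊗ Y)) V Z :
  ptr f (V ⊗ Z) ∘ α A V Z = α B V Z ∘ (ptr f V ▷ Z).
Proof.
rewrite /ptr -?compA -cup_tens !wl_comp -?compA -assoc_nat2.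
rewrite (ch2 (act_nat _ _)) -?compA !wr_comp.
rewrite (ch2 (assoc_nat2 _ _ _)) -?compA (kap_cap Y V) -cap_tens !wl_comp -?compA.
rewrite -kap_cap; congr (_ ∘ (_ ∘ _)).
by rewrite (ch3 (act_tens _ _ _)) -?compA.
Qed.

Definition ptr1 A B Y (f : hom (A ⊗ Y) (B ⊗ Y)) : hom A B :=
  runit B ∘ (ptr f 1 ∘ runit_inv A).

(** Compatibility with tails and the triangle axiom reduce every [Z] to the unit object. *)
Lemma ptrE A B Y (f : hom (A ⊗ Y) (B ⊗ Y)) Z : ptr f Z = ptr1 f ▷ Z.
Proof.
have e : (B ◁ lunit Z) ∘ (ptr f (1 ⊗ Z) ∘ α A 1 Z) = ptr f Z ∘ (runit A ▷ Z).
  by rewrite compA -ptr_nat -compA triangle.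
apply: (cancel_r (wr_inv Z (runitVK A))); rewrite -e ptr_tens.
by rewrite (ch2 (triangle _ _)) -!wr_comp /ptr1 -?compA runitK comp_idr.
Qed.

Lemma ptr_sum A B Y n (f : 'I_n -> hom (A ⊗ Y) (B ⊗ Y)) Z :
  ptr (\sum_i f i) Z = \sum_i ptr (f i) Z.
Proof.
rewrite /ptr actE wr_sum comp_suml !comp_sumr comp_suml comp_sumr.
by apply: eq_bigr => i _; rewrite actE.
Qed.

Lemma ptr_cyclic A B Y W (h : hom (A ⊗ Y) (B ⊗ W)) (g : hom W Y) Z :
  ptr ((B ◁ g) ∘ h) Z = ptr (h ∘ (A ◁ g)) Z.
Proof.
have [psi psiP] := mate_ex g; have [e1 e2] := psiP Z.
rewrite /ptr !act_comp !act_wl -?compA -!wl_comp e1.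
rewrite (ch2 (esym (wl_comp _ _ _))) -e2 !wl_comp -?compA.
by rewrite (ch2 (esym (act_nat _ _))) -?compA.
Qed.

Definition dbraid X Y : hom (X ⊗ Y) (X ⊗ Y) := locked (braid Y X ∘ braid X Y).

Lemma dbraidE X Y : dbraid X Y = braid Y X ∘ braid X Y.
Proof. by rewrite /dbraid -lock. Qed.

Lemma dbraid_natr X Y Y' (f : hom Y Y') :
  dbraid X Y' ∘ (X ◁ f) = (X ◁ f) ∘ dbraid X Y.
Proof. by rewrite !dbraidE -compA braid_nat compA braid_nat -compA. Qed.

(** Split the identity of [Y] into projectors; naturality and cyclicity bring each projection next
    to its injection, where they cancel. *)
Lemma ptr_dbraid_sum X n (Y_ : 'I_n -> C) Y Z : is_direct_sum Y_ Y ->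
  ptr (dbraid X Y) Z = \sum_i ptr (dbraid X (Y_ i)) Z.
Proof.
move=> [inj [prj [pi _ sum1]]].
have -> : dbraid X Y = \sum_i (X ◁ inj i) ∘ (dbraid X (Y_ i) ∘ (X ◁ prj i)).
  rewrite -[LHS]comp_idr -wl_id -sum1 wl_sum comp_sumr.
  by apply: eq_bigr => i _; rewrite wl_comp compA dbraid_natr -?compA dbraid_natr.
rewrite ptr_sum; apply: eq_bigr => i _.
by rewrite ptr_cyclic -compA -wl_comp pi wl_id comp_idr.
Qed.

(** By the hexagons the loop of Y ⊗ V encloses that of [V] between the two crossings with [Y]. The
    inner loop is the scalar [a], and what remains is the loop of [Y]. *)
Lemma ptr_dbraid_tens X Y V a Z :
  (forall Z', ptr (dbraid X V) Z' = a *: idm _) ->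
  ptr (dbraid X (Y ⊗ V)) Z = a *: ptr (dbraid X Y) Z.
Proof.
move=> aP; have [j [cupj kapj]] := nested_dual Y V Z.
set S := dual Y ⊗ Z in cupj kapj; pose T := dual V ⊗ S.
rewrite /ptr kapj !wl_comp -?compA (ch2 (esym (act_nat _ _))) -?compA.
have actD U A B : act (dbraid A B) U = β B A U ∘ β A B U by rewrite dbraidE act_comp.
have key : (X ◁ α Y V T) ∘ act (dbraid X (Y ⊗ V)) T =
    β Y X (V ⊗ T) ∘ ((Y ◁ act (dbraid X V) T) ∘ (β X Y (V ⊗ T) ∘ (X ◁ α Y V T))).
  rewrite !actD (ch2 (act_hexagon2 _ _ _ _)) -?compA -act_hexagon1.
  by rewrite wl_comp -?compA.
rewrite -?compA (ch2 key) -?compA -!wl_comp cupj !wl_comp -?compA.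
have step U (r : hom U (Y ⊗ (X ⊗ S))) : (Y ◁ (X ◁ kap V S)) ∘
    ((Y ◁ act (dbraid X V) T) ∘ ((Y ◁ (X ◁ cup (coev V) S)) ∘ r)) = a *: r.
  by rewrite !compA -!wl_comp -compA -/(ptr _ S) aP wl_linear wl_id compZl comp_idl.
rewrite (ch2 (act_nat _ _)) (ch2 (esym (act_nat _ _))) -?compA step actD.
by rewrite !compZr -?compA.
Qed.

End Ribbon.

(** * Fusion coefficients, invertible objects and the S-matrix *)

Section FusionRing.
Variables (K : numClosedFieldType) (C : ribbonFusionCategory K).
Implicit Types X Y Z : C.
Local Notation "1" := (unit_obj C) : cat_scope.
Local Notation dimhom X Y := (\dim {: hom X Y}).
Local Notation I := 'I_(rank C).+1.
Local Notation X_ := (@simp K C).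

Lemma tens_iso X X' Y Y' : isomorphic X X' -> isomorphic Y Y' -> isomorphic (X ⊗ Y) (X' ⊗ Y').
Proof.
move=> [f [f' [f'f ff']]] [g [g' [g'g gg']]]; exists (tensm f g), (tensm f' g').
by rewrite -!tensm_comp f'f ff' g'g gg' !tensm_id.
Qed.

Lemma braid_isomorphic X Y : isomorphic (X ⊗ Y) (Y ⊗ X).
Proof. by exists (braid X Y); exact: braid_iso. Qed.

Lemma runit_isomorphic X : isomorphic (X ⊗ 1) X.
Proof. by exists (runit X), (runit_inv X); rewrite runitK runitVK. Qed.

Lemma lunit_isomorphic X : isomorphic (1 ⊗ X) X.
Proof. by exists (lunit X), (lunit_inv X); rewrite lunitK lunitVK. Qed.

Lemma dimhom_adjoint X Y Z : dimhom (dual X ⊗ Y) Z = dimhom Y (X ⊗ Z).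
Proof.
pose F (f : hom (dual X ⊗ Y) Z) : hom Y (X ⊗ Z) := (X ◁ f) ∘ cup (coev X) Y.
pose G (g : hom Y (X ⊗ Z)) : hom (dual X ⊗ Y) Z := cap (ev X) Z ∘ (dual X ◁ g).
have linF : linear F.
  by move=> a f g; rewrite /F tensm_linearr comp_linearl.
have linG : linear G.
  by move=> a f g; rewrite /G tensm_linearr comp_linearr.
pose mF := GRing.isLinear.Build K _ _ _ F linF.
pose lF : {linear hom (dual X ⊗ Y) Z -> hom Y (X ⊗ Z)} := HB.pack F mF.
pose mG := GRing.isLinear.Build K _ _ _ G linG.
pose lG : {linear hom Y (X ⊗ Z) -> hom (dual X ⊗ Y) Z} := HB.pack G mG.
apply: (@dim_bij _ _ _ lF lG) => [f|g].
  change (G (F f) = f).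
  rewrite /F /G wl_comp compA cap_nat -compA (zigzag2 _ (dualP X)) comp_idr //.
change (F (G g) = g).
by rewrite /F /G wl_comp -compA -cup_nat (ch2 (zigzag1 _ (dualP X))) comp_idl.
Qed.

Local Notation dsym := (dimhom_sym (fus_abelian C) (@fus_semisimple K C)).

Lemma simp_simple i : simple_object (X_ i).
Proof. exact: rep_simple (@simpP K C) i. Qed.

Lemma simp_dimhom i j : dimhom (X_ i) (X_ j) = (i == j) :> nat.
Proof. exact: (rep_dimhom (fus_abelian C) (@simpP K C)). Qed.

Lemma simp_index_ex Y : dimhom Y Y = 1%N -> exists i, isomorphic Y (X_ i).
Proof. exact: (rep_index (fus_abelian C) (@fus_semisimple K C) (@simpP K C)). Qed.

(** Adjunction turns End(dual X) into Hom(1, X ⊗ dual X); the braiding, the symmetry of Hom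
    dimensions and a second adjunction lead to End(X). *)
Lemma dual_simple_dim X : simple_object X -> dimhom (dual X) (dual X) = 1%N.
Proof.
move=> sX; rewrite -(simple_dimhom (fus_abelian C) sX sX (isomorphic_refl X)).
rewrite -(dimhom_isol _ (runit_isomorphic (dual X))) dimhom_adjoint.
rewrite -(dimhom_isor _ (braid_isomorphic _ _)) dsym.
by rewrite dimhom_adjoint (dimhom_isor _ (runit_isomorphic X)).
Qed.

Lemma unit_simple : simple_object 1.
Proof. exact: (simple_of_dimhom1 (fus_abelian C) (@fus_semisimple K C) (fus_unit C)). Qed.

Definition unit_index_ex : exists i, isomorphic 1 (X_ i) := simp_index_ex (fus_unit C).

Lemma dual_index_ex : exists st : I -> I, forall i, isomorphic (dual (X_ i)) (X_ (st i)).
Proof.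
apply: (fin_all_exists (U := fun=> I) (P := fun i j => isomorphic (dual (X_ i)) (X_ j))).
by move=> i; apply: simp_index_ex; exact: dual_simple_dim (simp_simple i).
Qed.

Section Indices.
Variables (o : I) (st : I -> I).
Hypothesis oP : isomorphic 1 (X_ o).
Hypothesis stP : forall i, isomorphic (dual (X_ i)) (X_ (st i)).

Definition fusion_coef (i j k : I) : nat := multiplicity (X_ i ⊗ X_ j) k.
Local Notation N := fusion_coef.

Lemma fusion_coef_frob i j k : N i j k = N (st i) k j.
Proof.
rewrite /N /multiplicity -dimhom_adjoint dsym.
by rewrite (dimhom_isor _ (tens_iso (stP i) (isomorphic_refl (X_ k)))).
Qed.

Lemma fusion_coef_unit i j : N i j o = (j == st i) :> nat.
Proof.
rewrite /N /multiplicity -(dimhom_isol _ oP) -dimhom_adjoint.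
rewrite (dimhom_isol _ (runit_isomorphic _)) (dimhom_isol _ (stP i)) simp_dimhom.
by rewrite eq_sym.
Qed.

Lemma fusion_coefC i j k : N i j k = N j i k.
Proof. exact: dimhom_isor (braid_isomorphic _ _). Qed.

Lemma dual_indexK i : st (st i) = i.
Proof.
have := fusion_coef_unit i (st i); rewrite fusion_coefC fusion_coef_unit eqxx.
by case: eqP.
Qed.

Lemma multiplicity_unit k : multiplicity 1 k = (k == o) :> nat.
Proof. by rewrite /multiplicity (dimhom_isor _ oP) simp_dimhom. Qed.

Lemma multiplicity_dual i k : multiplicity (dual (X_ i)) k = (k == st i) :> nat.
Proof. by rewrite /multiplicity (dimhom_isor _ (stP i)) simp_dimhom. Qed.

Lemma multiplicity_dual_tens i k :
  multiplicity (X_ i ⊗ dual (X_ i)) k = N i (st i) k.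
Proof.
by rewrite /multiplicity (dimhom_isor _ (tens_iso (isomorphic_refl _) (stP i))).
Qed.

(** X ⊗ dual X is simple by its multiplicities, and so is dual X ⊗ X by the braiding. The duality
    equation makes [ev] and [coev] nonzero, hence isomorphisms by Schur's lemma. *)
Lemma invertible_of_fusion i : (forall k, N i (st i) k = (k == o) :> nat) ->
  invertible_object (X_ i).
Proof.
move=> Nk; set X := X_ i; pose Y := X ⊗ dual X.
have mY k : dimhom (X_ k) Y = (k == o) :> nat by rewrite -Nk -multiplicity_dual_tens.
have sY : simple_object Y.
  apply: (simple_of_dimhom1 (fus_abelian C) (@fus_semisimple K C)).
  rewrite (additive_decomposition (fus_abelian C) (@fus_semisimple K C) (@simpP K C)
    (phi := fun Z => dimhom Z Y)) => [|n Y_ Z]; last exact: dimhom_suml.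
  by rewrite (bigD1 o) //= !mY eqxx big1 // => k /negPf ko; rewrite mY ko.
have sY' : simple_object (dual X ⊗ X).
  apply: (simple_of_dimhom1 (fus_abelian C) (@fus_semisimple K C)).
  rewrite -(dimhom_isol _ (braid_isomorphic _ _)) -(dimhom_isor _ (braid_isomorphic _ _)).
  by rewrite simple_dimhom //; [exact: fus_abelian | exact: isomorphic_refl].
have [zz _] := dualP X.
have X0 : idm X != 0 := simple_id_neq0 (simp_simple i).
split.
  apply: (simple_hom_iso (fus_abelian C) sY' unit_simple); apply: contraNneq X0 => ev0.
  rewrite -zz ev0 -[0](scale0r (0 : hom _ _)) wl_linear scale0r.
  by rewrite comp0r !comp0l.
apply: (simple_hom_iso (fus_abelian C) unit_simple sY); apply: contraNneq X0 => coev0.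
rewrite -zz coev0 -[0](scale0r (0 : hom _ _)) wr_linear scale0r.
by rewrite comp0r comp0l.
Qed.

End Indices.

Section Loops.

Lemma simple_scalar X (f : hom X X) : simple_object X ->
  f = coord [tuple of [:: idm X]] ord0 f *: idm X.
Proof.
move=> sX; have [a ->] := simple_end (fus_abelian C) f sX.
have free1 : free [tuple of [:: idm X]] by rewrite seq1_free simple_id_neq0.
rewrite linearZ /=; congr (_ *: _).
by have := coord_free ord0 ord0 free1; rewrite /= => ->; rewrite /= mulr1.
Qed.

Variable k : I.
Local Notation X := (X_ k).

(** Encircling the simple object [X] by [Y] is an endomorphism of [X], hence a scalar: the one
    recorded here. *)
Definition loop Y : K := coord [tuple of [:: idm X]] ord0 (ptr1 (dbraid X Y)).

Lemma loopE Y Z : ptr (dbraid X Y) Z = loop Y *: idm _.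
Proof. by rewrite ptrE [ptr1 _](simple_scalar _ (simp_simple k)) wr_linear wr_id. Qed.

Lemma loop_sum n (Y_ : 'I_n -> C) Y : is_direct_sum Y_ Y -> loop Y = \sum_i loop (Y_ i).
Proof.
move=> dY; rewrite /loop -raddf_sum; congr (coord _ _ _).
rewrite /ptr1 (ptr_dbraid_sum _ _ dY) comp_suml comp_sumr.
by apply: eq_bigr.
Qed.

Lemma loop_iso Y Y' : isomorphic Y Y' -> loop Y = loop Y'.
Proof. by move/isomorphic_sum/loop_sum => ->; rewrite big_ord1. Qed.

Lemma loop_tens Y V : loop (Y ⊗ V) = loop Y * loop V.
Proof.
have e := ptr_dbraid_tens Y 1 (loopE V).
have : ptr1 (dbraid X (Y ⊗ V)) = loop V *: ptr1 (dbraid X Y).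
  by rewrite /ptr1 e compZl compZr.
by rewrite /loop => ->; rewrite linearZ /= mulrC.
Qed.

Lemma loop_fusion i j : loop (X_ i) * loop (X_ j) = \sum_l (fusion_coef i j l)%:R * loop (X_ l).
Proof.
rewrite -loop_tens (additive_decomposition (fus_abelian C) (@fus_semisimple K C) (@simpP K C) loop_sum).
by apply: eq_bigr => l _; rewrite mulr_natl.
Qed.

(** The trace over X ⊗ Y is the trace over [X] of the partial trace over [Y], which is the scalar
    [loop]. *)
Lemma Smatrix_loop i : Smatrix C k i = loop (X_ i) * ribbon_trace (idm X).
Proof.
rewrite mxE -dbraidE; set Y := X_ i.
have := nested_trace (dbraid X Y) 1.
set S := dual X ⊗ 1.
have -> : (X ◁ kap Y S) ∘ (act (dbraid X Y) (dual Y ⊗ S) ∘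
    ((X ◁ cup (coev Y) S) ∘ cup (coev X) 1)) = ptr (dbraid X Y) S ∘ cup (coev X) 1.
  by rewrite /ptr -!compA.
have := trace_tail (idm X) 1; rewrite wr_id comp_idl => tr1.
rewrite loopE compZl comp_idl compZr tr1 scalerA => /eqP.
by rewrite -subr_eq0 -scalerBl scaler_eq0 (negPf (unit_id_neq0 C)) orbF subr_eq0 => /eqP <-.
Qed.

End Loops.

Lemma Smatrix_sym i j : Smatrix C i j = Smatrix C j i.
Proof. by rewrite !mxE trace_cyclic. Qed.

Hypothesis S_unit : Smatrix C \in unitmx.

Lemma Smatrix_row_neq0 i : exists j, Smatrix C i j != 0.
Proof.
case: (pickP (fun j => Smatrix C i j != 0)) => [j Sij|S0]; first by exists j.
have : row i (Smatrix C) = 0.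
  by apply/rowP => j; rewrite mxE [RHS]mxE; apply/eqP/negbFE/S0.
rewrite rowE => /(canRL (mulmxK S_unit)); rewrite mul0mx => /rowP/(_ i)/eqP.
by rewrite !mxE !eqxx oner_eq0.
Qed.

Lemma dim_neq0 i : ribbon_trace (idm (X_ i)) != 0.
Proof.
have [j] := Smatrix_row_neq0 i; apply: contraNneq => d0.
by rewrite Smatrix_loop d0 mulr0.
Qed.

(** Since 1 ⊗ 1 is isomorphic to 1, this scalar is idempotent; were it zero, a whole row of the
    S-matrix would vanish. *)
Lemma loop_unit i : loop i 1 = 1%R.
Proof.
have e : loop i 1 * loop i 1 = loop i 1.
  by rewrite -loop_tens; apply: loop_iso; exact: lunit_isomorphic.
have l0 : loop i 1 != 0.
  have [j] := Smatrix_row_neq0 i; apply: contraNneq => l0.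
  rewrite Smatrix_loop -(loop_iso i (lunit_isomorphic (X_ j))) loop_tens l0.
  by rewrite !mul0r.
by apply: (mulfI l0); rewrite e mulr1.
Qed.

Section UnitIndex.
Variable o : I.
Hypothesis oP : isomorphic 1 (X_ o).

Lemma Smatrix_unit i : Smatrix C i o = ribbon_trace (idm (X_ i)).
Proof. by rewrite Smatrix_loop -(loop_iso i oP) loop_unit mul1r. Qed.

Lemma Smatrix_unit_neq0 i : Smatrix C i o != 0.
Proof. by rewrite Smatrix_unit dim_neq0. Qed.

Lemma Smatrix_ratio k i : Smatrix C k i / Smatrix C k o = loop k (X_ i).
Proof. by rewrite Smatrix_unit Smatrix_loop mulfK ?dim_neq0. Qed.

End UnitIndex.
End FusionRing.

(** * The Grothendieck ring *)

Local Open Scope complex_scope.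

Section ModularBurnside.
Variables (R : realType) (C : modularCategory R[i]).
Local Notation K := R[i].
Local Notation m := (rank C).+1.
Local Notation I := 'I_m.
Local Notation Hdual := 'Hom('rV[K]_m, K^o).
Local Notation N := (@fusion_coef K C).
Local Notation x i := (@gbasis K C K i).
Variables (o : I) (st : I -> I).
Hypothesis oP : isomorphic (unit_obj C) (simp o).
Hypothesis stP : forall i, isomorphic (dual (simp i)) (simp (st i)).

Let S : 'M[K]_m := Smatrix C.
Local Notation χ := (chi o S).

Let S_unit : S \in unitmx := modular_nondegenerate C.

Let S_o k : S k o != 0. Proof. exact: Smatrix_unit_neq0. Qed.
Let S_sym i j : S i j = S j i. Proof. exact: Smatrix_sym. Qed.
Let N_frob i j k : N i j k = N (st i) k j. Proof. exact: fusion_coef_frob. Qed.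
Let N_unit i j : N i j o = (j == st i) :> nat. Proof. exact: fusion_coef_unit. Qed.
Let stK i : st (st i) = i. Proof. exact: (dual_indexK oP). Qed.

Let chiM k i j : χ k i * χ k j = \sum_l (N i j l)%:R * χ k l.
Proof.
rewrite /chi !(Smatrix_ratio S_unit oP) loop_fusion.
by apply: eq_bigr => l _; rewrite (Smatrix_ratio S_unit oP).
Qed.

Lemma gclassE (A : comNzRingType) (Y : C) k : gclass A Y 0 k = (multiplicity Y k)%:R.
Proof.
rewrite summxE (bigD1 k) //= !mxE !eqxx mulr1 big1 ?addr0 // => j jk.
by rewrite !mxE eq_sym (negPf jk) andbF mulr0.
Qed.

Lemma gbasisE (A : comNzRingType) i k : @gbasis K C A i 0 k = (k == i)%:R.
Proof. by rewrite mxE eqxx. Qed.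

Lemma gmul_basis (A : comNzRingType) i (v : Groth C A) :
  gmul (gbasis A i) v = \sum_j v 0 j *: gclass A (simp i ⊗ simp j).
Proof.
rewrite /gmul (bigD1 i) //= [X in _ + X]big1 ?addr0 => [|k ki].
  by apply: eq_bigr => j _; rewrite gbasisE eqxx mul1r.
by apply: big1 => j _; rewrite gbasisE (negPf ki) mul0r scale0r.
Qed.

Lemma goneE (A : comNzRingType) : gone C A = gbasis A o.
Proof. by apply/rowP => k; rewrite gclassE gbasisE (multiplicity_unit oP). Qed.

Lemma gclass_dual (A : comNzRingType) i : gclass A (dual (simp i)) = @gbasis K C A (st i).
Proof. by apply/rowP => k; rewrite gclassE gbasisE (multiplicity_dual stP). Qed.

Lemma gmul_basis2 (A : comNzRingType) i j k :
  gmul (@gbasis K C A i) (gbasis A j) 0 k = (N i j k)%:R.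
Proof.
rewrite gmul_basis (bigD1 j) //= gbasisE eqxx scale1r big1 ?addr0 => [|l lj].
  exact: gclassE.
by rewrite gbasisE (negPf lj) scale0r.
Qed.

Lemma grouplike_fusion i :
  @grouplike K C i <-> forall k, N i (st i) k = (k == o) :> nat.
Proof.
rewrite /grouplike gclass_dual goneE; split=> [/rowP e k|e].
  have := e k; rewrite gmul_basis2 gbasisE => /eqP.
  by rewrite !natz => /eqP [].
by apply/rowP => k; rewrite gmul_basis2 gbasisE e.
Qed.

(** Every character maps the product of x_i with its dual to |chi_k(x_i)|^2, and the characters
    separate the elements of the ring. *)
Lemma grouplike_abs1 i : @grouplike K C i <-> abs1 o S i.
Proof.
rewrite grouplike_fusion; split=> [e k|a1].
  have : `|χ k i| ^+ 2 = 1.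
    rewrite normCK -(chi_st N_frob S_o chiM) chiM (bigD1 o) //= e eqxx mul1r big1 ?addr0.
      by rewrite /chi divff.
    by move=> l /negPf lo; rewrite e lo mul0r.
  by move/eqP; rewrite -[1 in X in X -> _](expr1n _ 2) eqrXn2 ?normr_ge0 ?ler01 // => /eqP.
move=> k; apply/eqP; rewrite -(eqr_nat K) -subr_eq0; apply/eqP.
apply: (chi_separating S_unit S_o (u := fun k => (N i (st i) k)%:R - (k == o)%:R)) => l.
under eq_bigr => j _ do rewrite mulrBl.
rewrite sumrB -chiM (chi_st N_frob S_o chiM) -normCK a1 expr1n (bigD1 o) //= eqxx mul1r.
rewrite big1 ?addr0 => [|j /negPf ->]; last by rewrite mul0r.
by rewrite /chi divff // subrr.
Qed.

Lemma perfect_abs1 : @perfect K C -> forall i, abs1 o S i -> i = o.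
Proof.
move=> perf i /grouplike_abs1/grouplike_fusion Ni.
have := perf _ (simp_simple i) (invertible_of_fusion stP Ni).
move=> /isomorphic_trans/(_ oP); have [_ inj _] := @simpP K C; exact: inj.
Qed.

Lemma hom_basis (f : Hdual) u : f u = \sum_i u 0 i * f (x i).
Proof.
rewrite [in LHS](row_sum_delta u) linear_sum; apply: eq_bigr => i _.
by rewrite linearZ.
Qed.

Lemma hom_ext (f g : Hdual) : (forall i, f (x i) = g (x i)) -> f = g.
Proof.
move=> fg; apply/lfunP => u; rewrite !hom_basis.
by apply: eq_bigr => i _; rewrite fg.
Qed.

Lemma algebra_morphism_character (f : Hdual) :
  @algebra_morphism R C f <-> fusion_character N o (fun i => f (x i)).
Proof.
rewrite /algebra_morphism goneE; split=> [[f1 fM]|[f1 fM]].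
  split=> // i j; rewrite -fM hom_basis; apply: eq_bigr => k _.
  by rewrite gmul_basis2.
split=> // u v; rewrite (hom_basis f u) (hom_basis f v) /gmul linear_sum mulr_suml.
apply: eq_bigr => i _; rewrite linear_sum mulr_sumr; apply: eq_bigr => j _.
rewrite linearZ /= mulrACA fM; congr (_ * _); rewrite hom_basis.
by apply: eq_bigr => k _; rewrite gclassE.
Qed.

Lemma form_chi k : @algebra_morphism R C (form (χ k)).
Proof.
apply/algebra_morphism_character.
have [c1 cM] := chi_character S_o chiM k.
by split=> [|i j]; rewrite ?formE //; under eq_bigr => l _ do rewrite formE.
Qed.

Lemma algebra_morphism_chi (f : Hdual) : @algebra_morphism R C f -> exists k, f = form (χ k).
Proof.
move/algebra_morphism_character/(character_chi N_frob S_unit S_o chiM) => [k fk].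
by exists k; apply: hom_ext => i; rewrite formE fk.
Qed.

Section FrobeniusPerron.
Variable q : I.
Hypothesis q_gt0 : forall i, 0 < χ q i.

(** The supremum is attained: [d i] is an eigenvalue with positive eigenvector [d], and
    [eigenvalue_le_dim] bounds all the others. *)
Lemma FPdimE i : (@FPdim R C i)%:C = χ q i.
Proof.
have [d dE] : exists d : I -> R, forall i, χ q i = (d i)%:C.
  exists (fun i => complex.Re (χ q i)) => j; apply/esym/RRe_real.
  by rewrite gtr0_real.
rewrite dE /FPdim; congr (_%:C).
have d_gt0 j : 0 < d j by have := q_gt0 j; rewrite dE ltcR.
set E : set R := [set r | _]%classic.
have Ed : E (d i).
  split; first exact: ltW.
  apply/eigenvalueP; exists (\row_j d j).
    apply/rowP => k; rewrite !mxE; apply: (fmorph_inj (real_complex R)).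
    have := dim_eigenvector N_frob S_o chiM q_gt0 i k.
    rewrite rmorph_sum rmorphM /= [χ q i]dE [χ q k]dE => <-; apply: eq_bigr => j _.
    by rewrite !mxE rmorphM rmorph_nat dE.
  by apply/eqP => /rowP/(_ o); rewrite !mxE; apply/eqP; rewrite gt_eqF.
have Eub : ubound E (d i).
  move=> r [r0 /eigenvalueP [v vE v0]].
  have : `|r%:C| <= χ q i.
    apply: (eigenvalue_le_dim (N := N) chiM q_gt0 (v := fun j => (v 0 j)%:C)).
      have /rV0Pn [j vj] := v0; exists j.
      by rewrite -(rmorph0 (real_complex R)) (inj_eq (@complexI R)).
    move=> k; move/rowP/(_ k): vE; rewrite !mxE => /(congr1 (real_complex R)).
    rewrite rmorph_sum rmorphM /= => <-; apply: eq_bigr => j _.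
    by rewrite !mxE rmorphM rmorph_nat.
  rewrite dE normc_def /= expr0n addr0 sqrtr_sqr lecR ger0_norm //.
apply/le_anti/andP; split.
  by apply: ge_sup => //; exists (d i).
by apply: ub_le_sup => //; exists (d i).
Qed.

Lemma integral_int_dims : integral_category C <-> int_dims o S q.
Proof.
split=> h i; have [z zE] := h i; exists z.
  by rewrite -FPdimE zE rmorph_int.
by apply: (@complexI R); rewrite FPdimE zE rmorph_int.
Qed.

Lemma burnsideE : burnside C <-> forall i, (exists k, χ k i = 0) <-> ~ abs1 o S i.
Proof.
have ex i : (exists f : Hdual, @algebra_morphism R C f /\ f (gbasis R[i] i) = 0) <->
    exists k, χ k i = 0.
  split=> [[f [/algebra_morphism_chi [k ->]]]|[k ck]]; first by rewrite formE; exists k.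
  by exists (form (χ k)); rewrite formE; split=> //; exact: form_chi.
split=> B i; first by rewrite -ex B grouplike_abs1.
by rewrite ex B grouplike_abs1.
Qed.


Local Notation dimq i := (χ q i).

Lemma FPdim_charE : FPdim_char C = form (χ q).
Proof. by apply: hom_ext => i; rewrite !formE FPdimE. Qed.

(** On characters the involution is complex conjugation, and the scaling by dimensions leaves one
    factor 1 / d_i. *)
Lemma star_sharpE (f : Hdual) i : @algebra_morphism R C f ->
  star f (@sharp R C f) (x i) = (dimq i)^-1 * `|f (x i)| ^+ 2.
Proof.
move=> /algebra_morphism_character fchar.
have d0 : dimq i != 0 by apply: lt0r_neq0.
rewrite formE FPdimE /= !linearZ /= /sharp formE gclass_dual.
rewrite (character_st N_frob i fchar) normCK.
have scaleE (a b : K) : (a *: (b : K^o)) = a * b by [].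
rewrite !scaleE; move: (χ q i) d0 => c c0.
by rewrite mulrACA -[X in _ * X]mulrA mulVKf.
Qed.

Lemma sharp_algebra_morphism (f : Hdual) :
  @algebra_morphism R C f -> @algebra_morphism R C (@sharp R C f).
Proof.
move=> /algebra_morphism_character fchar; apply/algebra_morphism_character.
have sE i : @sharp R C f (x i) = (f (x i))^*.
  by rewrite formE gclass_dual (character_st N_frob i fchar).
have [f1 fM] := fchar; split=> [|i j]; first by rewrite sE /= f1; exact: conjC1.
rewrite !sE -rmorphM fM rmorph_sum; apply: eq_bigr => l _.
by rewrite rmorphM rmorph_nat sE.
Qed.

(** Evaluation at the unit shows that the coefficient of FPdim is 1; the other basis elements then
    give |mu_j(x_i)|^2 = d_i^2. *)
Lemma dual_grouplikeE (mu : m.-tuple Hdual) j : @dual_basis R C mu ->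
  dual_grouplike mu j <-> forall i, `|tnth mu j (x i)| = dimq i.
Proof.
move=> [mu0 muP mubasis].
have muj : @algebra_morphism R C (tnth mu j) by apply/muP; exact: mem_tnth.
have [mu1 _] := (algebra_morphism_character _).1 muj.
have d0 i : dimq i != 0 by apply: lt0r_neq0.
split=> [[js [-> e]] i|abs].
  set c := dual_coef _ _ _ _ in e.
  have ci k : (dimq k)^-1 * `|tnth mu j (x k)| ^+ 2 = c * dimq k.
    have := congr1 (fun h : Hdual => h (x k)) e.
    by rewrite star_sharpE // scale_lfunE mu0 FPdim_charE formE.
  have c1 : c = 1.
    have := ci o; rewrite mu1 normr1 expr1n.
    by rewrite /chi divff // invr1 !mulr1 => <-.
  have := ci i; rewrite c1 mul1r => /(congr1 (fun z => dimq i * z)).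
  rewrite mulrA mulfV // mul1r -expr2 => /eqP.
  by rewrite eqrXn2 ?normr_ge0 ?ltW // => /eqP.
have /muP/tnthP [js jsE] := sharp_algebra_morphism muj.
exists js; split=> //.
have e0 : star (tnth mu j) (tnth mu js) = tnth mu ord0.
  rewrite -jsE mu0 FPdim_charE; apply: hom_ext => i.
  by rewrite star_sharpE // abs formE expr2 mulrA mulVf // mul1r.
rewrite /dual_coef e0 [X in coord _ _ X](tnth_nth 0) coord_free ?(basis_free mubasis) //.
by rewrite eqxx scale1r.
Qed.

Lemma dual_burnside_intro :
  (forall j, (forall i, χ j i != 0) -> forall i, `|χ j i| = dimq i) ->
  dual_burnside C.
Proof.
move=> DB.
(* The transposition puts the positive character first, as [dual_basis] demands. *)
pose mu : m.-tuple Hdual := [tuple form (χ (tperm ord0 q i)) | i < m].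
have muE i : tnth mu i = form (χ (tperm ord0 q i)) by rewrite tnth_mktuple.
have mu_dual : @dual_basis R C mu.
  split.
  - by rewrite muE tpermL FPdim_charE.
  - move=> f; split=> [/tnthP [i ->]|/algebra_morphism_chi [k ->]].
      by rewrite muE; exact: form_chi.
    by apply/tnthP; exists (tperm ord0 q k); rewrite muE tpermK.
  - have dimH : \dim {: Hdual} = m by rewrite dimvf /dim /= dim_matrix; apply: etrans (muln1 _) (mul1n _).
    rewrite basisEfree subvf size_tuple dimH leqnn !andbT.
    apply/freeP => c c0 i; pose u := \row_k c (tperm ord0 q k).
    have : u *m chi_mx o S = 0.
      apply/rowP => l; rewrite !mxE (reindex_inj (@perm_inj _ (tperm ord0 q))) /=.
      have := congr1 (fun h : Hdual => h (x l)) c0; rewrite sum_lfunE zero_lfunE => e.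
      rewrite -[RHS]e; apply: eq_bigr => k _.
      by rewrite !mxE tpermK scale_lfunE -tnth_nth muE formE.
    move/(canRL (mulmxK (chi_mx_unit S_unit S_o))); rewrite mul0mx => /rowP/(_ (tperm ord0 q i)).
    by rewrite !mxE tpermK.
exists mu; split=> // j; rewrite (dual_grouplikeE _ mu_dual) muE; split.
  move=> [l]; rewrite formE => c0 /(_ l); rewrite formE c0 normr0 => e.
  by have := q_gt0 l; rewrite -e ltxx.
move=> ngl; case: (pickP (fun i => χ (tperm ord0 q j) i == 0)) => [i /eqP c0|nz].
  by exists i; rewrite formE.
by case: ngl => i; rewrite formE; apply: DB => k; rewrite nz.
Qed.

Lemma dual_burnside_elim : dual_burnside C ->
  forall j, (forall i, χ j i != 0) -> forall i, `|χ j i| = dimq i.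
Proof.
move=> [mu [mu_dual muB]] j nz.
have [_ muP _] := mu_dual.
have /muP/tnthP [l lE] := form_chi j.
(* The boolean quantifier makes the double negation removable. *)
have gl : [forall i, `|χ j i| == dimq i].
  apply/negPn/negP => ngl.
  have /(muB l) [k] : ~ dual_grouplike mu l.
    move/(dual_grouplikeE _ mu_dual) => abs; case/negP: ngl; apply/forallP => i.
    by rewrite -abs -lE formE.
  by rewrite -lE formE => /eqP; apply/negP.
by move=> i; apply/eqP; move/forallP: gl.
Qed.

Lemma perfect_modular_burnside : @perfect K C ->
  (burnside C <-> integral_category C) /\ (dual_burnside C <-> integral_category C).
Proof.
move=> /perfect_abs1 perf; rewrite integral_int_dims burnsideE; split; split.
- move=> B; apply: (int_dims_of_unique S_unit S_o chiM q_gt0).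
  apply: (burnside_unique S_sym S_o q_gt0 perf) => i nz.
  have gl : [forall k, `|χ k i| == 1].
    apply/negPn/negP => ngl; have /(B i) [k /eqP] : ~ abs1 o S i.
      by move=> a1; case/negP: ngl; apply/forallP => k; rewrite a1.
    by apply/negP.
  by move=> k; apply/eqP; move/forallP: gl.
- move=> dint i; split=> [[k c0] /(_ k)/eqP|na1].
    by rewrite c0 normr0 eq_sym oner_eq0.
  case: (pickP (fun k => χ k i == 0)) => [k /eqP c0|nz]; first by exists k.
  case: na1; apply: (int_burnside N_frob S_unit S_sym S_o chiM q_gt0 dint) => k.
  by rewrite nz.
- move/dual_burnside_elim => DB; apply: (int_dims_of_unique S_unit S_o chiM q_gt0).
  exact: (dual_burnside_unique N_frob S_unit S_sym S_o chiM q_gt0 perf DB).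
- move=> dint; apply: dual_burnside_intro.
  exact: (int_dual_burnside N_frob S_unit S_sym S_o chiM q_gt0 dint).
Qed.

End FrobeniusPerron.

Lemma exists_FP_index : exists q, forall i, 0 < χ q i.
Proof. exact: (exists_positive_character N_frob N_unit stK S_unit S_o chiM). Qed.

End ModularBurnside.

Theorem theorem1p27 (R : realType) (C : modularCategory R[i]) :
  perfect C ->
  (burnside C <-> integral_category C) /\
  (dual_burnside C <-> integral_category C).
Proof.
(* The simple objects come in no prescribed order, so the indices of the unit, of the duals and of
   the positive character have to be chosen. *)
have [o oP] := unit_index_ex C; have [st stP] := dual_index_ex C.
have [q q_gt0] := exists_FP_index oP stP.
exact: (perfect_modular_burnside oP stP q_gt0).
Qed.
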